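(* Let $w^{(1)},w^{(2)},\ldots$ be a sequence of weight vectors, where $w^{(k)}=(w^{(k)}_1,\ldots,w^{(k)}_{n_k})$ has positive entries and length $n_k$, and the sequence $(n_k)$ is increasing. Assume that there is a constant $C$, independent of $k$, such that $$\frac{\max_i w^{(k)}_i}{\min_i w^{(k)}_i}\le C\qquad\text{for all }k.$$ Then, for data $f\in\mathbb R^{n_k}$ and weights $w^{(k)}$, the $L^1$-Potts algorithm (described in the context) computes an exact minimizer $u\in\mathbb R^{n_k}$ of the discrete weighted $L^1$-Potts functional $$u\mapsto \gamma J(u)+\sum_{i=1}^{n_k} w^{(k)}_i|u_i-f_i|$$ within $O(n_k^2)$ time and $O(n_k)$ space as $k$ increases.
   Context: $\gamma>0$ is a parameter and $J(u)=\#\{i: u_i\ne u_{i+1}\}$ for a vector $u$. Time counts arithmetic operations, comparisons and pointer operations on reals/indices at unit cost with exact real arithmetic; space counts stored reals, indices and pointers. For data $f\in\mathbb R^n$ and positive weights $w$, a weighted median of $f_{[\ell,r]}=(f_\ell,\ldots,f_r)$ is a minimizer of $y\mapsto\sum_{i=\ell}^r w_i|f_i-y|$, and $d_{[\ell,r]}$ denotes the minimal value. The $L^1$-Potts algorithm, with input $f\in\mathbb R^n$, $w\in\mathbb R_{>0}^n$, $\gamma$: It maintains an indexed linked histogram $H$, i.e. a doubly linked list of nodes sorted by value, one node for each distinct value among the data inserted so far, each storing the value, the accumulated weight of the data with that value, and in addition a temporary weight and temporary next/previous pointers; an array $I$ stores for each data index $i$ a pointer to the node with value $f_i$. Set $P_0=-\gamma$.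 For $r=1,\ldots,n$: (1) set $P_r=\infty$; insert $f_r$ with weight $w_r$ into $H$ by linear search (creating a node if necessary) and set $I_r$; (2) reset all temporary weights and pointers to the permanent ones; find a median node $M$ of $H$ by traversing the list, and compute $d=d_{[1,r]}$ by summation; (3) for $\ell=1,\ldots,r$: set $p=P_{\ell-1}+\gamma+d$; if $p\le P_r$, set $P_r=p$ and $Z_r=\ell-1$; then subtract $w_\ell$ from the temporary weight of the node pointed to by $I_\ell$, remove that node from the temporary list if its temporary weight becomes $0$, and shift $M$ step by step along the temporary list until it is a median node of the temporary histogram, updating $d$ along with each shift (so that $d=d_{[\ell+1,r]}$). Finally, the output $u$ is reconstructed from $Z$: with $m_0=n$, $m_{t+1}=Z_{m_t}$, until reaching $0$, $u$ is set on each block of indices $m_{t+1}+1,\ldots,m_t$ to a weighted median of the data on that block. *)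

(* Defs.v *)
From HB Require Import structures.
From mathcomp Require Import all_boot all_order all_algebra.
From mathcomp Require Export reals constructive_ereal.

Set Implicit Arguments.
Unset Strict Implicit.
Unset Printing Implicit Defensive.

Import Order.TTheory GRing.Theory Num.Theory.

Section Potts.
Local Open Scope ring_scope.
Variable R : realDomainType.

Definition jumps n (u : 'rV[R]_n) : nat :=
  #|[set ij : 'I_n * 'I_n |
      (ij.2 == ij.1.+1 :> nat) && (u 0 ij.1 != u 0 ij.2)]|.

Definition potts n (gamma : R) (w f u : 'rV[R]_n) : R :=
  gamma * (jumps u)%:R + \sum_(i < n) w 0 i * `|u 0 i - f 0 i|.

Definition potts_minimizer n (gamma : R) (w f u : 'rV[R]_n) : Prop :=
  forall v : 'rV[R]_n, potts gamma w f u <= potts gamma w f v.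

(* The default values of the iterated maximum and minimum are harmless for    *)
(* vectors of positive length with positive entries.                          *)
Definition max_entry n (w : 'rV[R]_n) : R := \big[Num.max/0]_(i < n) w 0 i.

Definition min_entry n (w : 'rV[R]_n) : R :=
  \big[Num.min/max_entry w]_(i < n) w 0 i.

End Potts.

Variant ivar : Type :=
  | vN    (* length of the data *)
  | vR    (* r *)
  | vL    (* l *)
  | vI    (* loop index *)
  | vX    (* node pointer *)
  | vC    (* number of nodes in use *)
  | vM    (* the median node M *)
  | vA    (* block of the reconstruction is a+1, ..., b *)
  | vB.

Variant rvar : Type :=
  | vGamma
  | vD    (* d *)
  | vP    (* p *)
  | vWl   (* total temporary weight of the nodes to the left of M *)
  | vWr.  (* total temporary weight of the nodes to the right of M *)

Variant iarr : Type :=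
  | aNext | aPrev     (* permanent pointers of a node *)
  | aTNext | aTPrev   (* temporary pointers of a node *)
  | aNode             (* the array I *)
  | aZ.

Variant rarr : Type :=
  | aF | aW           (* input *)
  | aVal | aWgt       (* value and permanent weight of a node *)
  | aTWgt             (* temporary weight of a node *)
  | aP
  | aU.               (* output *)

Definition ivar_code x : 'I_9 :=
  match x with
  | vN => @Ordinal 9 0 isT | vR => @Ordinal 9 1 isT | vL => @Ordinal 9 2 isT
  | vI => @Ordinal 9 3 isT | vX => @Ordinal 9 4 isT | vC => @Ordinal 9 5 isT
  | vM => @Ordinal 9 6 isT | vA => @Ordinal 9 7 isT | vB => @Ordinal 9 8 isT
  end.
Definition ivar_decode (i : 'I_9) : option ivar :=
  onth [:: vN; vR; vL; vI; vX; vC; vM; vA; vB] i.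
Lemma ivar_codeK : pcancel ivar_code ivar_decode. Proof. by case. Qed.
HB.instance Definition _ := Finite.copy ivar (pcan_type ivar_codeK).

Definition rvar_code x : 'I_5 :=
  match x with
  | vGamma => @Ordinal 5 0 isT | vD => @Ordinal 5 1 isT
  | vP => @Ordinal 5 2 isT | vWl => @Ordinal 5 3 isT | vWr => @Ordinal 5 4 isT
  end.
Definition rvar_decode (i : 'I_5) : option rvar :=
  onth [:: vGamma; vD; vP; vWl; vWr] i.
Lemma rvar_codeK : pcancel rvar_code rvar_decode. Proof. by case. Qed.
HB.instance Definition _ := Finite.copy rvar (pcan_type rvar_codeK).

Definition iarr_code x : 'I_6 :=
  match x with
  | aNext => @Ordinal 6 0 isT | aPrev => @Ordinal 6 1 isT
  | aTNext => @Ordinal 6 2 isT | aTPrev => @Ordinal 6 3 isT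
  | aNode => @Ordinal 6 4 isT | aZ => @Ordinal 6 5 isT
  end.
Definition iarr_decode (i : 'I_6) : option iarr :=
  onth [:: aNext; aPrev; aTNext; aTPrev; aNode; aZ] i.
Lemma iarr_codeK : pcancel iarr_code iarr_decode. Proof. by case. Qed.
HB.instance Definition _ := Finite.copy iarr (pcan_type iarr_codeK).

Definition rarr_code x : 'I_7 :=
  match x with
  | aF => @Ordinal 7 0 isT | aW => @Ordinal 7 1 isT | aVal => @Ordinal 7 2 isT
  | aWgt => @Ordinal 7 3 isT | aTWgt => @Ordinal 7 4 isT
  | aP => @Ordinal 7 5 isT | aU => @Ordinal 7 6 isT
  end.
Definition rarr_decode (i : 'I_7) : option rarr :=
  onth [:: aF; aW; aVal; aWgt; aTWgt; aP; aU] i.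
Lemma rarr_codeK : pcancel rarr_code rarr_decode. Proof. by case. Qed.
HB.instance Definition _ := Finite.copy rarr (pcan_type rarr_codeK).

(* Programs only contain the real constants 0 and +oo, so the syntax does not *)
(* mention the field of reals, and all computation on reals goes through the  *)
(* operations below.  A pointer is an index into parallel arrays.             *)

Inductive iexp : Type :=
  | IVar of ivar
  | INum of nat
  | IGet of iarr & iexp
  | IAdd of iexp & iexp
  | ISub of iexp & iexp.   (* truncated *)

Declare Scope iexp_scope.
Delimit Scope iexp_scope with iexp.
Bind Scope iexp_scope with iexp.

Inductive rexp : Type :=
  | RVar of rvar
  | RZero
  | RInfty
  | RGet of rarr & iexp
  | RAdd of rexp & rexp
  | RSub of rexp & rexp
  | RMul of rexp & rexp
  | RAbs of rexp.

Declare Scope rexp_scope.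
Delimit Scope rexp_scope with rexp.
Bind Scope rexp_scope with rexp.

Inductive bexp : Type :=
  | BIeq of iexp & iexp
  | BIle of iexp & iexp
  | BReq of rexp & rexp
  | BRle of rexp & rexp
  | BRlt of rexp & rexp
  | BNot of bexp
  | BAnd of bexp & bexp.

Declare Scope bexp_scope.
Delimit Scope bexp_scope with bexp.
Bind Scope bexp_scope with bexp.

Inductive cmd : Type :=
  | Skip
  | SetI of ivar & iexp            (* assignment to a variable *)
  | SetR of rvar & rexp
  | PutI of iarr & iexp & iexp     (* PutI a i e  is  a[i] := e *)
  | PutR of rarr & iexp & rexp
  | AllocI of iarr & iexp          (* new array of the given length *)
  | AllocR of rarr & iexp
  | Seq of cmd & cmd
  | If of bexp & cmd & cmd
  | While of bexp & cmd.

Declare Scope cmd_scope.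
Delimit Scope cmd_scope with cmd.
Bind Scope cmd_scope with cmd.

(* Real cells range over \bar R, the value +oo being needed for the array P.  *)
(* An access outside of the bounds of an array is an error (None), hence a    *)
(* terminating run only uses cells that have been allocated.                  *)

Section Machine.
Variable R : realDomainType.

Record memory : Type := Memory {
  ireg : ivar -> nat;
  rreg : rvar -> \bar R;
  iheap : iarr -> seq nat;
  rheap : rarr -> seq (\bar R) }.

Implicit Types m : memory.

Definition olift2 A B C (op : A -> B -> C) (x : option A) (y : option B) :=
  obind (fun a => omap (op a) y) x.

Fixpoint ieval m e : option nat :=
  match e with
  | IVar x => Some (ireg m x)
  | INum k => Some k
  | IGet a e => obind (onth (iheap m a)) (ieval m e)
  | IAdd e1 e2 => olift2 addn (ieval m e1) (ieval m e2)
  | ISub e1 e2 => olift2 subn (ieval m e1) (ieval m e2)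
  end.

Fixpoint reval m e : option (\bar R) :=
  match e with
  | RVar x => Some (rreg m x)
  | RZero => Some 0%E
  | RInfty => Some +oo%E
  | RGet a e => obind (onth (rheap m a)) (ieval m e)
  | RAdd e1 e2 => olift2 (fun x y => x + y)%E (reval m e1) (reval m e2)
  | RSub e1 e2 => olift2 (fun x y => x - y)%E (reval m e1) (reval m e2)
  | RMul e1 e2 => olift2 (fun x y => x * y)%E (reval m e1) (reval m e2)
  | RAbs e => omap (fun x => `|x|%E) (reval m e)
  end.

(* In a conjunction the right operand is evaluated only if the left one is    *)
(* true; bcost below charges for both in all cases.                           *)
Fixpoint beval m b : option bool :=
  match b with
  | BIeq e1 e2 => olift2 (fun x y => x == y) (ieval m e1) (ieval m e2)
  | BIle e1 e2 => olift2 leq (ieval m e1) (ieval m e2)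
  | BReq e1 e2 => olift2 (fun x y => x == y) (reval m e1) (reval m e2)
  | BRle e1 e2 => olift2 (fun x y => (x <= y)%E) (reval m e1) (reval m e2)
  | BRlt e1 e2 => olift2 (fun x y => (x < y)%E) (reval m e1) (reval m e2)
  | BNot b => omap negb (beval m b)
  | BAnd b1 b2 => obind (fun v => if v then beval m b2 else Some false)
                        (beval m b1)
  end.

Fixpoint icost e : nat :=
  match e with
  | IVar _ | INum _ => 1
  | IGet _ e => (icost e).+1
  | IAdd e1 e2 | ISub e1 e2 => (icost e1 + icost e2).+1
  end.

Fixpoint rcost e : nat :=
  match e with
  | RVar _ | RZero | RInfty => 1
  | RGet _ e => (icost e).+1
  | RAdd e1 e2 | RSub e1 e2 | RMul e1 e2 => (rcost e1 + rcost e2).+1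
  | RAbs e => (rcost e).+1
  end.

Fixpoint bcost b : nat :=
  match b with
  | BIeq e1 e2 | BIle e1 e2 => (icost e1 + icost e2).+1
  | BReq e1 e2 | BRle e1 e2 | BRlt e1 e2 => (rcost e1 + rcost e2).+1
  | BNot b => (bcost b).+1
  | BAnd b1 b2 => (bcost b1 + bcost b2).+1
  end.

Definition set_ireg m x v :=
  Memory [eta ireg m with x |-> v] (rreg m) (iheap m) (rheap m).
Definition set_rreg m x v :=
  Memory (ireg m) [eta rreg m with x |-> v] (iheap m) (rheap m).
Definition set_iheap m a s :=
  Memory (ireg m) (rreg m) [eta iheap m with a |-> s] (rheap m).
Definition set_rheap m a s :=
  Memory (ireg m) (rreg m) (iheap m) [eta rheap m with a |-> s].

Definition space m : nat :=
  #|{: ivar}| + #|{: rvar}| + \sum_a size (iheap m a) + \sum_a size (rheap m a).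

(* exec c m t s m' : started in the memory m, the program c terminates        *)
(* without error in the memory m' after t operations, and s is the largest    *)
(* number of cells in use during the run.  Allocation is charged for the      *)
(* initialization of the new cells.                                           *)
Inductive exec : cmd -> memory -> nat -> nat -> memory -> Prop :=
  | exec_skip m : exec Skip m 1 (space m) m
  | exec_setI m x e v (m' := set_ireg m x v) of ieval m e = Some v :
      exec (SetI x e) m (icost e).+1 (maxn (space m) (space m')) m'
  | exec_setR m x e v (m' := set_rreg m x v) of reval m e = Some v :
      exec (SetR x e) m (rcost e).+1 (maxn (space m) (space m')) m'
  | exec_putI m a i e k v (m' := set_iheap m a (set_nth 0 (iheap m a) k v)) of
      ieval m i = Some k & k < size (iheap m a) & ieval m e = Some v :
      exec (PutI a i e) m (icost i + icost e).+1
           (maxn (space m) (space m')) m'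
  | exec_putR m a i e k v (m' := set_rheap m a (set_nth 0%E (rheap m a) k v)) of
      ieval m i = Some k & k < size (rheap m a) & reval m e = Some v :
      exec (PutR a i e) m (icost i + rcost e).+1
           (maxn (space m) (space m')) m'
  | exec_allocI m a e k (m' := set_iheap m a (nseq k 0)) of
      ieval m e = Some k :
      exec (AllocI a e) m (icost e + k).+1 (maxn (space m) (space m')) m'
  | exec_allocR m a e k (m' := set_rheap m a (nseq k 0%E)) of
      ieval m e = Some k :
      exec (AllocR a e) m (icost e + k).+1 (maxn (space m) (space m')) m'
  | exec_seq c1 c2 m m1 m2 t1 t2 s1 s2 of
      exec c1 m t1 s1 m1 & exec c2 m1 t2 s2 m2 :
      exec (Seq c1 c2) m (t1 + t2) (maxn s1 s2) m2
  | exec_if b c1 c2 m m' v t s of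
      beval m b = Some v & exec (if v then c1 else c2) m t s m' :
      exec (If b c1 c2) m (bcost b + t) s m'
  | exec_while_stop b c m of beval m b = Some false :
      exec (While b c) m (bcost b) (space m) m
  | exec_while_step b c m m1 m2 t1 t2 s1 s2 of
      beval m b = Some true & exec c m t1 s1 m1 &
      exec (While b c) m1 t2 s2 m2 :
      exec (While b c) m (bcost b + t1 + t2) (maxn s1 s2) m2.

(* A program has at most one run from a given memory.                         *)
Lemma exec_det c m t s m' t1 s1 m1 :
  exec c m t s m' -> exec c m t1 s1 m1 -> [/\ t = t1, s = s1 & m' = m1].
Proof.
have inj A (o : option A) v v' : o = Some v -> o = Some v' -> v = v'.
  by move=> -> [].
move=> E; move: t1 s1 m1; induction E => t' s' m'' E'; inversion E'; subst;
  rewrite ?/m' ?/m'0 //;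
  repeat match goal with
    | e1 : ?o = Some ?v, e2 : ?o = Some ?v' |- _ =>
        have := inj _ _ _ _ e1 e2; clear e2; (discriminate || move=> ?; subst)
    end => //.
- match goal with E3 : exec c1 _ _ _ _, E4 : exec c2 _ _ _ _ |- _ =>
    have [? ? ?] := IHE1 _ _ _ E3; subst; by have [-> -> ->] := IHE2 _ _ _ E4
  end.
- match goal with E3 : exec (if _ then _ else _) _ t0 _ _ |- _ =>
    by have [-> -> ->] := IHE _ _ _ E3
  end.
- match goal with E3 : exec c _ t0 _ _, E4 : exec (While b c) _ t3 _ _ |- _ =>
    have [? ? ?] := IHE1 _ _ _ E3; subst; by have [-> -> ->] := IHE2 _ _ _ E4
  end.
Qed.

(* Vectors are stored from cell 1 on; cell 0 is a dummy.                      *)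
Definition vec_array n (v : 'rV[R]_n) : seq (\bar R) :=
  0%E :: [seq (v 0%R i)%:E | i <- enum 'I_n].

Definition input n (gamma : R) (w f : 'rV[R]_n) : memory :=
  Memory (fun x => if x == vN then n else 0)
         (fun x => if x == vGamma then gamma%:E else 0%E)
         (fun=> [::])
         (fun a => match a with
                   | aF => vec_array f
                   | aW => vec_array w
                   | _ => [::]
                   end).

End Machine.

(* All indices start at 1, as in vec_array.  The nodes of the histogram are   *)
(* numbered 1, ..., c.  Cell 0 of the pointer arrays is the header of the     *)
(* doubly linked list: it points to the first and to the last node, and the   *)
(* pointer 0 marks both ends of the list.                                     *)

Arguments If _%_bexp _%_cmd _%_cmd.
Arguments While _%_bexp _%_cmd.

Coercion IVar : ivar >-> iexp.
Coercion INum : nat >-> iexp.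
Coercion RVar : rvar >-> rexp.

Notation "a .[ e ]" := (IGet a e%iexp) : iexp_scope.
Notation "e1 + e2" := (IAdd e1%iexp e2%iexp) : iexp_scope.
Notation "e1 - e2" := (ISub e1%iexp e2%iexp) : iexp_scope.
Notation "a .[ e ]" := (RGet a e%iexp) : rexp_scope.
Notation "e1 + e2" := (RAdd e1%rexp e2%rexp) : rexp_scope.
Notation "e1 - e2" := (RSub e1%rexp e2%rexp) : rexp_scope.
Notation "e1 * e2" := (RMul e1%rexp e2%rexp) : rexp_scope.
Notation "`| e |" := (RAbs e%rexp) : rexp_scope.
Notation "e1 == e2" := (BReq e1%rexp e2%rexp) : bexp_scope.
Notation "e1 <= e2" := (BRle e1%rexp e2%rexp) : bexp_scope.
Notation "e1 < e2" := (BRlt e1%rexp e2%rexp) : bexp_scope.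
Notation "~~ b" := (BNot b%bexp) : bexp_scope.
Notation "b1 && b2" := (BAnd b1%bexp b2%bexp) : bexp_scope.
Notation "c1 ;; c2" := (Seq c1%cmd c2%cmd)
  (at level 100, right associativity, format "c1 ;; '/' c2") : cmd_scope.

Definition clear_histogram : cmd :=
  SetI vC 0;;
  PutI aNext 0 0;;
  PutI aPrev 0 0.

Definition insert (i : ivar) : cmd :=
  SetI vX aNext.[0];;
  While (~~ BIeq vX 0 && (aVal.[vX] < aF.[i])) (
    SetI vX aNext.[vX]
  );;
  If (~~ BIeq vX 0 && (aVal.[vX] == aF.[i])) (
    PutR aWgt vX (aWgt.[vX] + aW.[i])
  ) (
    SetI vC (vC + 1);;
    PutR aVal vC aF.[i];;
    PutR aWgt vC aW.[i];;
    PutI aNext vC vX;;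
    PutI aPrev vC aPrev.[vX];;
    PutI aNext aPrev.[vX] vC;;
    PutI aPrev vX vC;;
    SetI vX vC
  );;
  PutI aNode i vX.

Definition reset_temporary : cmd :=
  PutI aTNext 0 aNext.[0];;
  PutI aTPrev 0 aPrev.[0];;
  SetI vX aNext.[0];;
  While (~~ BIeq vX 0) (
    PutR aTWgt vX aWgt.[vX];;
    PutI aTNext vX aNext.[vX];;
    PutI aTPrev vX aPrev.[vX];;
    SetI vX aNext.[vX]
  ).

(* One step of M to the right, respectively left, in the temporary list.      *)
(* While M moves from y to y' > y, the sum of the w_i |f_i - y| changes by    *)
(* (y' - y) times the difference of the weights of {f_i <= y} and {f_i > y}.  *)
Definition shift_right : cmd :=
  SetR vD (vD + (aVal.[aTNext.[vM]] - aVal.[vM])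
                * (vWl + aTWgt.[vM] - vWr));;
  SetR vWl (vWl + aTWgt.[vM]);;
  SetI vM aTNext.[vM];;
  SetR vWr (vWr - aTWgt.[vM]).

Definition shift_left : cmd :=
  SetR vD (vD + (aVal.[vM] - aVal.[aTPrev.[vM]])
                * (vWr + aTWgt.[vM] - vWl));;
  SetR vWr (vWr + aTWgt.[vM]);;
  SetI vM aTPrev.[vM];;
  SetR vWl (vWl - aTWgt.[vM]).

(* M is a median node iff none of the weights strictly to its left and        *)
(* strictly to its right exceeds half of the total weight.                    *)
Definition find_median : cmd :=
  SetI vM aTNext.[0];;
  SetR vWl RZero;;
  SetR vWr RZero;;
  SetI vX aTNext.[vM];;
  While (~~ BIeq vX 0) (
    SetR vWr (vWr + aTWgt.[vX]);;
    SetI vX aTNext.[vX]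
  );;
  While (vWl + aTWgt.[vM] < vWr) (
    SetR vWl (vWl + aTWgt.[vM]);;
    SetI vM aTNext.[vM];;
    SetR vWr (vWr - aTWgt.[vM])
  ).

Definition sum_deviations : cmd :=
  SetR vD RZero;;
  SetI vX aTNext.[0];;
  While (~~ BIeq vX 0) (
    SetR vD (vD + aTWgt.[vX] * `|aVal.[vX] - aVal.[vM]|);;
    SetI vX aTNext.[vX]
  ).

(* Removes the l-th datum from the temporary histogram; M, which may be the   *)
(* node that is unlinked, stays put.                                          *)
Definition remove_temporary : cmd :=
  SetI vX aNode.[vL];;
  SetR vD (vD - aW.[vL] * `|aF.[vL] - aVal.[vM]|);;
  If (aVal.[vX] < aVal.[vM]) (
    SetR vWl (vWl - aW.[vL])
  ) (
    If (aVal.[vM] < aVal.[vX]) (SetR vWr (vWr - aW.[vL])) Skip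
  );;
  PutR aTWgt vX (aTWgt.[vX] - aW.[vL]);;
  If (aTWgt.[vX] == RZero) (
    PutI aTNext aTPrev.[vX] aTNext.[vX];;
    PutI aTPrev aTNext.[vX] aTPrev.[vX]
  ) Skip.

(* If M itself has been unlinked, it is first moved to a neighbour, towards   *)
(* the heavier side.                                                          *)
Definition shift_median : cmd :=
  If (aTWgt.[vM] == RZero) (If (vWl <= vWr) shift_right shift_left) Skip;;
  While (vWl + aTWgt.[vM] < vWr) shift_right;;
  While (vWr + aTWgt.[vM] < vWl) shift_left.

Definition allocate : cmd :=
  AllocI aNext (vN + 1);;
  AllocI aPrev (vN + 1);;
  AllocI aTNext (vN + 1);;
  AllocI aTPrev (vN + 1);;
  AllocI aNode (vN + 1);;
  AllocI aZ (vN + 1);;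
  AllocR aVal (vN + 1);;
  AllocR aWgt (vN + 1);;
  AllocR aTWgt (vN + 1);;
  AllocR aP (vN + 1);;
  AllocR aU (vN + 1).

(* After l = r the temporary histogram is empty and there is no median.       *)
Definition dynamic_program : cmd :=
  clear_histogram;;
  PutR aP 0 (RZero - vGamma);;
  SetI vR 1;;
  While (BIle vR vN) (
    PutR aP vR RInfty;;
    insert vR;;
    reset_temporary;;
    find_median;;
    sum_deviations;;
    SetI vL 1;;
    While (BIle vL vR) (
      SetR vP (aP.[vL - 1] + vGamma + vD);;
      If (vP <= aP.[vR]) (
        PutR aP vR vP;;
        PutI aZ vR (vL - 1)
      ) Skip;;
      remove_temporary;;
      If (BIeq vL vR) Skip shift_median;;
      SetI vL (vL + 1)
    );;
    SetI vR (vR + 1)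
  ).

(* The median of a block is found with a new histogram of its data. *)
Definition reconstruct : cmd :=
  SetI vB vN;;
  While (~~ BIeq vB 0) (
    SetI vA aZ.[vB];;
    clear_histogram;;
    SetI vI (vA + 1);;
    While (BIle vI vB) (
      insert vI;;
      SetI vI (vI + 1)
    );;
    reset_temporary;;
    find_median;;
    SetI vI (vA + 1);;
    While (BIle vI vB) (
      PutR aU vI aVal.[vM];;
      SetI vI (vI + 1)
    );;
    SetI vB vA
  ).

Definition l1_potts : cmd :=
  allocate;;
  dynamic_program;;
  reconstruct.

(* Main.v *)
Require Import Defs.
From HB Require Import structures.
From mathcomp Require Import all_boot all_order all_algebra.
From mathcomp Require Import reals constructive_ereal.
From mathcomp Require Import zify ring lra.

Set Implicit Arguments.
Unset Strict Implicit.
Unset Printing Implicit Defensive.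

Import Order.TTheory GRing.Theory Num.Theory.
Local Open Scope ring_scope.

(* Correctness is the usual dynamic programming argument: splitting off the  *)
(* last block [l, r] shows that P_r is the optimal value on the first r data, *)
(* and following Z backwards recovers a segmentation whose value is at most   *)
(* P_n.                                                                       *)
(*   The running time hinges on the number of shifts of M after the removal   *)
(* of the datum l.  Before the removal the weights strictly to the left and   *)
(* to the right of M differ by at most the weight of M, and the removal       *)
(* changes this balance by w_l at most, while each shift moves at least       *)
(* min_i w_i from one side to the other.  Hence max_i w_i / min_i w_i <= C    *)
(* bounds the number of shifts by a constant, and the two nested loops of the *)
(* dynamic program take O(n^2) steps.                                         *)

(** The mathematics sits in two inequalities about the numbers [p r] stored in the array P, with
    [p 0 = - gamma] so that the first block is charged no jump. If every [p r] is at most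
    [p l.-1 + gamma + dev] for all blocks [l, r] and all constants, then [p n] is at most the
    functional at any vector: follow its last constant block and induct ([segmentation_lower]). If
    moreover Z_r points to an l - 1 for which the bound is attained from above, then gluing the
    blocks found by following Z from n down to 0 never costs more than [p n] ([segmentation_step]).
    So the vector written by the program is a minimizer.

    What the program must guarantee is that d is the minimal deviation on [l, r] whenever it is
    read. The node M is a median exactly when neither side outweighs the other side plus M, and then
    its value minimizes the deviation ([dev_median]). Between consecutive values the deviation is
    affine with slope the difference of the two side masses ([dev_shift]), so d is updated in
    constant time. The linked list is followed through [hist], the relation between pointers,
    weights and a block of data; insertion and unlinking preserve it ([hist_add_new],
    [hist_remove_drop]).

    For the time, [remove_temporary_spec] bounds the loss of balance by the removed weight, and
    [shift_median_spec] turns this into at most K shifts per loop, where K times the least weight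
    bounds every weight. Each round r then costs O(n) for insertion, reset, search and summation,
    plus O(n) removals of constant cost. The reconstruction also takes O(n^2), since each datum is
    inserted once more. Space is read off the final memory, as no array ever shrinks. *)

(** * Program logic *)

Section Logic.
Variable R : realDomainType.
Implicit Types (m : memory R) (c : cmd) (Q : memory R -> Prop).

(** Total evaluation with a default value, paired with a test [idef] that no access is out of
    bounds. On a concrete program both simplify, which leaves only bounds checks to prove. *)
Fixpoint itot m e : nat :=
  match e with
  | IVar x => ireg m x
  | INum k => k
  | IGet a e => nth 0%N (iheap m a) (itot m e)
  | IAdd e1 e2 => itot m e1 + itot m e2
  | ISub e1 e2 => itot m e1 - itot m e2
  end.

Fixpoint idef m e : bool :=
  match e with
  | IVar _ | INum _ => true
  | IGet a e => idef m e && (itot m e < size (iheap m a))%N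
  | IAdd e1 e2 | ISub e1 e2 => idef m e1 && idef m e2
  end.

Fixpoint rtot m e : \bar R :=
  match e with
  | RVar x => rreg m x
  | RZero => 0%E
  | RInfty => +oo%E
  | RGet a e => nth 0%E (rheap m a) (itot m e)
  | RAdd e1 e2 => rtot m e1 + rtot m e2
  | RSub e1 e2 => rtot m e1 - rtot m e2
  | RMul e1 e2 => rtot m e1 * rtot m e2
  | RAbs e => `|rtot m e|
  end%E.

Fixpoint rdef m e : bool :=
  match e with
  | RVar _ | RZero | RInfty => true
  | RGet a e => idef m e && (itot m e < size (rheap m a))%N
  | RAdd e1 e2 | RSub e1 e2 | RMul e1 e2 => rdef m e1 && rdef m e2
  | RAbs e => rdef m e
  end.

Fixpoint btot m b : bool :=
  match b with
  | BIeq e1 e2 => itot m e1 == itot m e2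
  | BIle e1 e2 => (itot m e1 <= itot m e2)%N
  | BReq e1 e2 => rtot m e1 == rtot m e2
  | BRle e1 e2 => (rtot m e1 <= rtot m e2)%E
  | BRlt e1 e2 => (rtot m e1 < rtot m e2)%E
  | BNot b => ~~ btot m b
  | BAnd b1 b2 => btot m b1 && btot m b2
  end.

Fixpoint bdef m b : bool :=
  match b with
  | BIeq e1 e2 | BIle e1 e2 => idef m e1 && idef m e2
  | BReq e1 e2 | BRle e1 e2 | BRlt e1 e2 => rdef m e1 && rdef m e2
  | BNot b => bdef m b
  | BAnd b1 b2 => bdef m b1 && (btot m b1 ==> bdef m b2)
  end.

Lemma onth_some T (x0 : T) s k : (k < size s)%N -> onth s k = Some (nth x0 s k).
Proof. by elim: s k => [|x s IHs] [|k] //=; apply: IHs. Qed.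

Lemma ieval_tot m e : idef m e -> ieval m e = Some (itot m e).
Proof.
elim: e => //= [a e IHe /andP[/IHe-> /=] | e1 IH1 e2 IH2 | e1 IH1 e2 IH2].
- exact: onth_some.
- by case/andP=> /IH1-> /IH2->.
- by case/andP=> /IH1-> /IH2->.
Qed.

Lemma reval_tot m e : rdef m e -> reval m e = Some (rtot m e).
Proof.
elim: e => //= [a e /andP[/ieval_tot-> /=] | e1 IH1 e2 IH2 | e1 IH1 e2 IH2
  | e1 IH1 e2 IH2 | e IHe /IHe-> //].
- exact: onth_some.
- by case/andP=> /IH1-> /IH2->.
- by case/andP=> /IH1-> /IH2->.
- by case/andP=> /IH1-> /IH2->.
Qed.

Lemma beval_tot m b : bdef m b -> beval m b = Some (btot m b).
Proof.
elim: b => /= [e1 e2|e1 e2|e1 e2|e1 e2|e1 e2|b IHb|b1 IH1 b2 IH2].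
- by case/andP=> /ieval_tot-> /ieval_tot->.
- by case/andP=> /ieval_tot-> /ieval_tot->.
- by case/andP=> /reval_tot-> /reval_tot->.
- by case/andP=> /reval_tot-> /reval_tot->.
- by case/andP=> /reval_tot-> /reval_tot->.
- by move=> /IHb->.
- by case/andP=> /IH1-> /=; case: ifP => //= _ /IH2.
Qed.

(** * Syntactic footprints and frames *)

Fixpoint writes_ireg c (x : ivar) : bool :=
  match c with
  | SetI y _ => x == y
  | Seq c1 c2 | If _ c1 c2 => writes_ireg c1 x || writes_ireg c2 x
  | While _ c => writes_ireg c x
  | _ => false
  end.

Fixpoint writes_rreg c (x : rvar) : bool :=
  match c with
  | SetR y _ => x == y
  | Seq c1 c2 | If _ c1 c2 => writes_rreg c1 x || writes_rreg c2 x
  | While _ c => writes_rreg c x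
  | _ => false
  end.

Fixpoint writes_iheap c (a : iarr) : bool :=
  match c with
  | PutI b _ _ | AllocI b _ => a == b
  | Seq c1 c2 | If _ c1 c2 => writes_iheap c1 a || writes_iheap c2 a
  | While _ c => writes_iheap c a
  | _ => false
  end.

Fixpoint writes_rheap c (a : rarr) : bool :=
  match c with
  | PutR b _ _ | AllocR b _ => a == b
  | Seq c1 c2 | If _ c1 c2 => writes_rheap c1 a || writes_rheap c2 a
  | While _ c => writes_rheap c a
  | _ => false
  end.

Fixpoint alloc_free c : bool :=
  match c with
  | AllocI _ _ | AllocR _ _ => false
  | Seq c1 c2 | If _ c1 c2 => alloc_free c1 && alloc_free c2
  | While _ c => alloc_free c
  | _ => true
  end.

(** The footprint is computed from the program text, so that for a concrete command the preservation
    of a register or array is settled by evaluation. *)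
Record frame c m m' : Prop := Frame {
  frame_ireg x : ~~ writes_ireg c x -> ireg m' x = ireg m x;
  frame_rreg x : ~~ writes_rreg c x -> rreg m' x = rreg m x;
  frame_iheap a : ~~ writes_iheap c a -> iheap m' a = iheap m a;
  frame_rheap a : ~~ writes_rheap c a -> rheap m' a = rheap m a;
  frame_isize a : alloc_free c -> size (iheap m' a) = size (iheap m a);
  frame_rsize a : alloc_free c -> size (rheap m' a) = size (rheap m a) }.

Lemma frame_refl c m : frame c m m. Proof. by []. Qed.

Lemma frame_trans c m1 m2 m3 : frame c m1 m2 -> frame c m2 m3 -> frame c m1 m3.
Proof.
move=> [f1 f2 f3 f4 f5 f6] [g1 g2 g3 g4 g5 g6]; split=> z cz.
- by rewrite g1 ?f1.
- by rewrite g2 ?f2.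
- by rewrite g3 ?f3.
- by rewrite g4 ?f4.
- by rewrite g5 ?f5.
- by rewrite g6 ?f6.
Qed.

Lemma frame_sub c c' m m' :
  (forall x, writes_ireg c x -> writes_ireg c' x) ->
  (forall x, writes_rreg c x -> writes_rreg c' x) ->
  (forall x, writes_iheap c x -> writes_iheap c' x) ->
  (forall x, writes_rheap c x -> writes_rheap c' x) ->
  (alloc_free c' -> alloc_free c) -> frame c m m' -> frame c' m m'.
Proof.
move=> h1 h2 h3 h4 h5 [f1 f2 f3 f4 f5 f6]; split=> z cz.
- by apply: f1; apply: contra cz; apply: h1.
- by apply: f2; apply: contra cz; apply: h2.
- by apply: f3; apply: contra cz; apply: h3.
- by apply: f4; apply: contra cz; apply: h4.
- by apply: f5; apply: h5.
- by apply: f6; apply: h5.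
Qed.

Lemma size_set_nth_in T (x0 : T) s k v :
  (k < size s)%N -> size (set_nth x0 s k v) = size s.
Proof. by move=> ks; rewrite size_set_nth; apply/maxn_idPr. Qed.

Lemma exec_frame c m t s m' : exec c m t s m' -> frame c m m'.
Proof.
elim=> {c m t s m'} //.
- by move=> m x e v /= _; split=> //= y /negPf->.
- by move=> m x e v /= _; split=> //= y /negPf->.
- move=> m a i e k v /= _ ks _; split=> //= b; first by move/negPf->.
  by case: eqP => // -> _; rewrite size_set_nth_in.
- move=> m a i e k v /= _ ks _; split=> //= b; first by move/negPf->.
  by case: eqP => // -> _; rewrite size_set_nth_in.
- by move=> m a e k m' _; split=> //= y /negPf->.
- by move=> m a e k m' _; split=> //= y /negPf->.
- move=> c1 c2 m m1 m2 t1 t2 s1 s2 _ F1 _ F2; apply: (@frame_trans _ _ m1).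
    by apply: frame_sub F1 => /= [x ->|x ->|x ->|x ->|/andP[]].
  by apply: frame_sub F2 => /= [x ->|x ->|x ->|x ->|/andP[]]; rewrite ?orbT.
- by move=> b c1 c2 m m' [] t s _ _;
  apply: frame_sub => /= [x ->|x ->|x ->|x ->|/andP[]]; rewrite ?orbT.
- move=> b c m m1 m2 t1 t2 s1 s2 _ _ F1 _; apply: frame_trans.
  by apply: frame_sub F1.
Qed.

(** * Total correctness with time and space bounds *)

(* The bound s <= Defs.space m' makes the space of a run that only enlarges   *)
(* arrays readable off its final memory.                                      *)
Definition runs c m (T : nat) Q : Prop :=
  exists t s m', [/\ exec c m t s m', (t <= T)%N, (s <= Defs.space m')%N,
                     (Defs.space m <= Defs.space m')%N & Q m'].

Lemma runs_weaken c m T T' Q Q' :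
  runs c m T Q -> (forall m', frame c m m' -> Q m' -> Q' m') -> (T <= T')%N ->
  runs c m T' Q'.
Proof.
move=> [t [s [m' [E tT ss sm Qm]]]] QQ' TT'; exists t, s, m'; split=> //.
  exact: leq_trans TT'.
by apply: QQ' Qm; apply: exec_frame E.
Qed.

Lemma runs_seq c1 c2 m T1 T2 T Q1 Q :
  runs c1 m T1 Q1 ->
  (forall m', frame c1 m m' -> Q1 m' -> runs c2 m' T2 Q) ->
  (T1 + T2 <= T)%N -> runs (Seq c1 c2) m T Q.
Proof.
move=> [t1 [s1 [m1 [E1 t1T ss1 sm1 Q1m]]]] H TT.
have [t2 [s2 [m2 [E2 t2T ss2 sm2 Qm]]]] := H _ (exec_frame E1) Q1m.
exists (t1 + t2)%N, (maxn s1 s2), m2; split=> //.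
- exact: exec_seq E1 E2.
- exact: leq_trans (leq_add t1T t2T) TT.
- by rewrite geq_max ss2 (leq_trans ss1).
- exact: leq_trans sm2.
Qed.

(** Programs nest to the right; regrouping the commands before a loop makes them one loop-free
    command, to which [runs_wp] applies. *)
Lemma runs_assoc c1 c2 c3 m T Q :
  runs (Seq (Seq c1 c2) c3) m T Q -> runs (Seq c1 (Seq c2 c3)) m T Q.
Proof.
move=> [t [s [m' [E tT ss sm Qm]]]]; exists t, s, m'; split=> //.
inversion E as [| | | | | | |? ? ? ? ? ? ? ? ? E12 E3| | |]; subst.
inversion E12 as [| | | | | | |? ? ? ? ? ? ? ? ? E1 E2| | |]; subst.
by rewrite -addnA -maxnA; apply: exec_seq E1 _; apply: exec_seq E2 E3.
Qed.

Lemma runs_if b c1 c2 m T T' Q :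
  bdef m b -> (btot m b -> runs c1 m T Q) -> (~~ btot m b -> runs c2 m T Q) ->
  (bcost b + T <= T')%N -> runs (If b c1 c2) m T' Q.
Proof.
move=> bd H1 H2 TT; suff [t [s [m' [E tT ss sm Qm]]]] :
    runs (if btot m b then c1 else c2) m T Q.
  exists (bcost b + t)%N, s, m'; split=> //; last by apply: leq_trans TT;
    rewrite leq_add2l.
  by apply: exec_if E; apply: beval_tot.
by case: ifPn.
Qed.

(** Here [k] is a potential: a pass may be expensive if it lowers [k] by much, and the sum over all
    passes telescopes. The frame from [m0] is supplied at each pass, so the invariant need not
    repeat what the loop leaves alone. *)
Lemma runs_while_amortized (I : nat -> memory R -> Prop) k b c m0 B T Q :
  I k m0 ->
  (forall k m, frame c m0 m -> I k m -> bdef m b /\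
     if btot m b then exists T', runs c m T' (fun m' =>
       exists k', [/\ (k' < k)%N, (T' <= (k - k') * B)%N & I k' m'])
     else Q m) ->
  (k * (bcost b + B) + bcost b <= T)%N ->
  runs (While b c) m0 T Q.
Proof.
move=> Ik H TT; suff: runs (While b c) m0 (k * (bcost b + B) + bcost b) Q.
  by move/runs_weaken; apply.
suff G k' m : I k' m -> frame c m0 m ->
    runs (While b c) m (k' * (bcost b + B) + bcost b) Q.
  by apply: G Ik _; apply: frame_refl.
move=> {TT}{}Ik fr; move: k' Ik fr => {}k Ik fr.
have [n] := ubnP k; elim: n => // n IHn in k m Ik fr *; rewrite ltnS => kn.
have [bd] := H _ _ fr Ik; case: ifP => bt; last first.
  move=> Qm; exists (bcost b), (Defs.space m), m; split=> //;
    last exact: leq_addl.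
  by apply: exec_while_stop; rewrite beval_tot ?bt.
move=> [T' [t1 [s1 [m1 [E1 t1T ss1 sm1 [k' [k'k T'B Ik']]]]]]].
have [|t2 [s2 [m2 [E2 t2T ss2 sm2 Qm]]]] :=
  IHn _ _ Ik' (frame_trans fr (exec_frame E1)); first exact: leq_trans kn.
exists (bcost b + t1 + t2)%N, (maxn s1 s2), m2; split=> //.
- by apply: exec_while_step E1 E2; rewrite beval_tot ?bt.
- have le : (bcost b + t1 <= (k - k') * (bcost b + B))%N.
    by rewrite mulnDr leq_add ?(leq_trans t1T) // leq_pmull // subn_gt0.
  apply: leq_trans (leq_add le t2T) _.
  by rewrite addnA -mulnDl subnK // ltnW.
- by rewrite geq_max ss2 (leq_trans ss1).
- exact: leq_trans sm2.
Qed.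

Lemma runs_while (I : nat -> memory R -> Prop) k b c m0 B T Q :
  I k m0 ->
  (forall k m, frame c m0 m -> I k m -> bdef m b /\
     if btot m b then runs c m B (fun m' => exists2 k', (k' < k)%N & I k' m')
     else Q m) ->
  (k * (bcost b + B) + bcost b <= T)%N ->
  runs (While b c) m0 T Q.
Proof.
move=> Ik H; apply: runs_while_amortized (Ik) _ => k' m fr Ikm.
have [bd Hm] := H _ _ fr Ikm; split=> //; case: ifP Hm => // _ Hm; exists B.
apply: runs_weaken Hm _ (leqnn B) => m' _ [k2 k2k Ik2]; exists k2; split=> //.
by rewrite leq_pmull // subn_gt0.
Qed.

(** * Weakest preconditions of loop-free commands, and allocation *)

Fixpoint wp c Q m : Prop :=
  match c with
  | Skip => Q m
  | SetI x e => idef m e /\ Q (set_ireg m x (itot m e))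
  | SetR x e => rdef m e /\ Q (set_rreg m x (rtot m e))
  | PutI a i e =>
      [/\ idef m i, (itot m i < size (iheap m a))%N, idef m e &
          Q (set_iheap m a (set_nth 0 (iheap m a) (itot m i) (itot m e)))]
  | PutR a i e =>
      [/\ idef m i, (itot m i < size (rheap m a))%N, rdef m e &
          Q (set_rheap m a (set_nth 0%E (rheap m a) (itot m i) (rtot m e)))]
  | AllocI a e => [/\ idef m e, (size (iheap m a) <= itot m e)%N &
      Q (set_iheap m a (nseq (itot m e) 0))]
  | AllocR a e => [/\ idef m e, (size (rheap m a) <= itot m e)%N &
      Q (set_rheap m a (nseq (itot m e) 0%E))]
  | Seq c1 c2 => wp c1 (wp c2 Q) m
  | If b c1 c2 => bdef m b /\ if btot m b then wp c1 Q m else wp c2 Q m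
  | While _ _ => False
  end%N.

Fixpoint cost c : nat :=
  match c with
  | Skip => 1
  | SetI _ e => (icost e).+1
  | SetR _ e => (rcost e).+1
  | PutI _ i e => (icost i + icost e).+1
  | PutR _ i e => (icost i + rcost e).+1
  | Seq c1 c2 => cost c1 + cost c2
  | If b c1 c2 => bcost b + maxn (cost c1) (cost c2)
  | AllocI _ _ | AllocR _ _ | While _ _ => 0
  end.

Lemma space_set_iheap m a s : (size (iheap m a) <= size s)%N ->
  (Defs.space m <= Defs.space (set_iheap m a s))%N.
Proof.
move=> ss; rewrite /Defs.space leq_add2r leq_add2l; apply: leq_sum => b _ /=.
by case: eqP => // ->.
Qed.

Lemma space_set_rheap m a s : (size (rheap m a) <= size s)%N ->
  (Defs.space m <= Defs.space (set_rheap m a s))%N.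
Proof.
move=> ss; rewrite /Defs.space leq_add2l; apply: leq_sum => b _ /=.
by case: eqP => // ->.
Qed.

Lemma runs_wp c m T Q :
  alloc_free c -> wp c Q m -> (cost c <= T)%N -> runs c m T Q.
Proof.
elim: c m T Q => [|x e|x e|a i e|a i e|a e|a e|c1 IH1 c2 IH2|b c1 IH1 c2 IH2|b
  c IH] m T Q //=.
- by move=> _ Qm T0; exists 1%N, (Defs.space m), m; split=> //;
  apply: exec_skip.
- move=> _ [de Qm] T0; eexists _, _, _; split; last exact: Qm; last by [].
  + by apply: exec_setI; apply: ieval_tot.
  + exact: T0.
  + by rewrite maxnn.
- move=> _ [de Qm] T0; eexists _, _, _; split; last exact: Qm; last by [].
  + by apply: exec_setR; apply: reval_tot.
  + exact: T0.
  + by rewrite maxnn.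
- move=> _ [di si de Qm] T0; eexists _, _, _; split; last exact: Qm.
  + by apply: exec_putI si _; apply: ieval_tot.
  + exact: T0.
  + by rewrite geq_max leqnn space_set_iheap ?size_set_nth_in.
  + by rewrite space_set_iheap ?size_set_nth_in.
- move=> _ [di si de Qm] T0; eexists _, _, _; split; last exact: Qm.
  + by apply: exec_putR si _; [apply: ieval_tot | apply: reval_tot].
  + exact: T0.
  + by rewrite geq_max leqnn space_set_rheap ?size_set_nth_in.
  + by rewrite space_set_rheap ?size_set_nth_in.
- move=> /andP[a1 a2] W T0; apply: runs_seq (IH1 _ _ _ a1 W (leqnn _)) _ T0.
  by move=> m' _ W2; apply: IH2.
- move=> /andP[a1 a2] [bd W] T0; apply: runs_if bd _ _ T0.
    by move=> bt; apply: IH1; rewrite ?leq_maxl //; move: W; rewrite bt.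
  by move=> bt; apply: IH2; rewrite ?leq_maxr //; move: W; rewrite (negPf bt).
Qed.

Lemma runs_allocI a e m T Q :
  idef m e -> (size (iheap m a) <= itot m e)%N ->
  Q (set_iheap m a (nseq (itot m e) 0%N)) -> (icost e + itot m e < T)%N ->
  runs (AllocI a e) m T Q.
Proof.
move=> de se Qm T0; eexists _, _, _; split; last exact: Qm.
- by apply: exec_allocI; apply: ieval_tot.
- exact: T0.
- by rewrite geq_max leqnn space_set_iheap ?size_nseq.
- by rewrite space_set_iheap ?size_nseq.
Qed.

Lemma runs_allocR a e m T Q :
  idef m e -> (size (rheap m a) <= itot m e)%N ->
  Q (set_rheap m a (nseq (itot m e) 0%E)) -> (icost e + itot m e < T)%N ->
  runs (AllocR a e) m T Q.
Proof.
move=> de se Qm T0; eexists _, _, _; split; last exact: Qm.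
- by apply: exec_allocR; apply: ieval_tot.
- exact: T0.
- by rewrite geq_max leqnn space_set_rheap ?size_nseq.
- by rewrite space_set_rheap ?size_nseq.
Qed.

Lemma runs_allocI_seq a e c m T1 T2 T Q :
  idef m e -> (size (iheap m a) <= itot m e)%N -> (icost e + itot m e < T1)%N ->
  runs c (set_iheap m a (nseq (itot m e) 0%N)) T2 Q -> (T1 + T2 <= T)%N ->
  runs (Seq (AllocI a e) c) m T Q.
Proof.
move=> de se le H; apply: (runs_seq (Q1 := eq (set_iheap m a (nseq (itot m e)
  0%N)))).
  exact: runs_allocI.
by move=> m' _ <-.
Qed.

Lemma runs_allocR_seq a e c m T1 T2 T Q :
  idef m e -> (size (rheap m a) <= itot m e)%N -> (icost e + itot m e < T1)%N ->
  runs c (set_rheap m a (nseq (itot m e) 0%E)) T2 Q -> (T1 + T2 <= T)%N ->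
  runs (Seq (AllocR a e) c) m T Q.
Proof.
move=> de se le H; apply: (runs_seq (Q1 := eq (set_rheap m a (nseq (itot m e)
  0%E)))).
  exact: runs_allocR.
by move=> m' _ <-.
Qed.

End Logic.

(** * Linked histograms *)

Section Chain.
Implicit Types (f g : nat -> nat) (s : seq nat).

(* Previous pointers form the chain of rev s, so that insertion and removal   *)
(* are verified once for both directions.                                     *)
Definition chain f s : bool := fpath f 0%N (rcons s 0%N).

(** No pointer is followed out of the last point of a path, hence [belast]. *)
Lemma eq_in_fpath f g x s :
  {in belast x s, f =1 g} -> fpath f x s -> fpath g x s.
Proof.
elim: s x => //= y s IHs x fg /andP[/eqP fxy ps].
rewrite /= -fg ?mem_head // fxy eqxx /=.
by apply: IHs ps => z zs; apply: fg; rewrite in_cons zs orbT.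
Qed.

Lemma fpath_rcons_head f x s :
  fpath f x (rcons s 0%N) =
  (f x == head 0%N s) && fpath f (head 0%N s) (behead (rcons s 0%N)).
Proof. by case: s. Qed.

Lemma belast_head_rcons s : belast (head 0%N s) (behead (rcons s 0%N)) = s.
Proof. by case: s => //= x s; rewrite belast_rcons. Qed.

Lemma chain_cat f s1 s2 :
  chain f (s1 ++ s2) = [&& fpath f 0%N s1, f (last 0%N s1) == head 0%N s2 &
                        fpath f (head 0%N s2) (behead (rcons s2 0%N))].
Proof. by rewrite /chain rcons_cat cat_path fpath_rcons_head. Qed.

Lemma chain_next f s1 s2 : chain f (s1 ++ s2) -> f (last 0%N s1) = head 0%N s2.
Proof. by rewrite chain_cat => /and3P[_ /eqP]. Qed.

Lemma eq_in_chain f g s : {in 0%N :: s, f =1 g} -> chain f s -> chain g s.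
Proof. by move=> fg; apply: eq_in_fpath; rewrite belast_rcons. Qed.

Lemma last_notin_belast s : uniq (0%N :: s) -> last 0%N s \notin belast 0%N s.
Proof. by rewrite lastI rcons_uniq => /andP[]. Qed.

Lemma mem_belast_last s : {subset belast 0%N s <= 0%N :: s}.
Proof. by move=> x xs; rewrite lastI mem_rcons in_cons xs orbT. Qed.

(** The only pointer that crosses from [s1] to [s2] leaves [last 0 s1]. By uniqueness that cell
    occurs nowhere else, so redirecting it does not disturb the two halves. *)
Lemma chain_relink f g s1 s2 :
  uniq (0%N :: s1 ++ s2) -> fpath f 0%N s1 ->
  fpath f (head 0%N s2) (behead (rcons s2 0%N)) ->
  g (last 0%N s1) = head 0%N s2 ->
  {in 0%N :: s1 ++ s2, forall y, y != last 0%N s1 -> f y = g y} ->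
  chain g (s1 ++ s2).
Proof.
rewrite -cat_cons cat_uniq => /and3P[u1 /hasPn u12 u2] p1 p2 gl fg.
rewrite chain_cat gl eqxx /=; apply/andP; split.
  apply: eq_in_fpath p1 => y yb; apply: fg.
    by rewrite mem_cat mem_belast_last.
  by apply: contraNneq (last_notin_belast u1) => <-.
apply: eq_in_fpath p2; rewrite belast_head_rcons => y ys; apply: fg.
  by rewrite mem_cat ys orbT.
by apply: contraNneq (u12 y ys) => ->;
  rewrite -[_ \in _]/(_ \in 0%N :: s1) mem_last.
Qed.

Lemma chain_remove f g s1 x s2 :
  uniq (0%N :: s1 ++ x :: s2) -> chain f (s1 ++ x :: s2) ->
  g (last 0%N s1) = head 0%N s2 ->
  (forall y, y != last 0%N s1 -> g y = f y) -> chain g (s1 ++ s2).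
Proof.
move=> u ch gl gf; apply: (@chain_relink f) gl _.
- apply: subseq_uniq u; rewrite /= cat_subseq //.
  exact: subseq_cons.
- by move: ch; rewrite chain_cat => /and3P[].
- by move: ch; rewrite chain_cat => /and3P[_ _] /=;
  rewrite fpath_rcons_head => /andP[].
- by move=> y _ /gf.
Qed.

Lemma chain_insert f g s1 x s2 :
  uniq (0%N :: s1 ++ x :: s2) -> chain f (s1 ++ s2) ->
  g x = head 0%N s2 -> g (last 0%N s1) = x ->
  (forall y, y != x -> y != last 0%N s1 -> g y = f y) -> chain g (s1 ++ x ::
    s2).
Proof.
move=> u ch gx gl gf.
have xs: x \notin 0%N :: s1 ++ s2.
  move: u; rewrite -cat_cons uniq_catC cat_cons cons_uniq => /andP[+ _].
  by rewrite mem_cat orbC -mem_cat.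
(* The pointer of the new cell is set first: [h] still follows [s1 ++ s2] and already leads from [x]
   into [s2], so one relinking remains. *)
pose h y := if y == x then head 0%N s2 else f y.
have hf: {in 0%N :: s1 ++ s2, f =1 h}.
  by move=> y ys; rewrite /h; case: eqP => // yx; rewrite yx (negPf xs) in ys.
have := eq_in_chain hf ch; rewrite chain_cat => /and3P[p1 _ p2].
apply: (@chain_relink h) u p1 _ gl _.
  by rewrite /= fpath_rcons_head p2 /h eqxx eqxx.
move=> y _ yl; rewrite /h; case: eqP => [->|/eqP yx]; first by rewrite gx.
by rewrite gf.
Qed.

End Chain.

(** * Absolute deviations and masses of sets of nodes *)

Section Deviation.
Variables (R : realDomainType) (F W : nat -> R).
Implicit Types (a b : nat) (y z : R) (nd : nat -> nat) (t s : seq nat).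

Definition dev a b y : R := \sum_(a <= i < b) W i * `|F i - y|.

(** Summation is over data rather than nodes, so adding or removing a datum changes one summand. *)
Definition nmass a b nd t : R := \sum_(a <= i < b) W i *+ (nd i \in t).

Lemma nmass_nil a b nd : nmass a b nd [::] = 0.
Proof. by rewrite /nmass big1. Qed.

Lemma nmass_cat a b nd t1 t2 :
  uniq (t1 ++ t2) -> nmass a b nd (t1 ++ t2) = nmass a b nd t1 + nmass a b nd
    t2.
Proof.
rewrite cat_uniq => /and3P[_ /hasPn t12 _]; rewrite -big_split /=.
apply: eq_bigr => i _; rewrite mem_cat -mulrnDr.
by case: (boolP (nd i \in t2)) => [/t12/negPf->|]; rewrite ?orbF ?addn0.
Qed.

Lemma nmass_cons a b nd x t :
  uniq (x :: t) -> nmass a b nd (x :: t) = nmass a b nd [:: x] + nmass a b nd t.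
Proof. by move=> u; rewrite -nmass_cat. Qed.

Lemma nmass_recl a b nd t : (a < b)%N ->
  nmass a b nd t = W a *+ (nd a \in t) + nmass a.+1 b nd t.
Proof. by move=> ab; rewrite /nmass big_ltn. Qed.

Lemma nmass_recr a b nd t : (a <= b)%N ->
  nmass a b.+1 nd t = nmass a b nd t + W b *+ (nd b \in t).
Proof. by move=> ab; rewrite /nmass big_nat_recr. Qed.

Lemma nmass_ge0 a b nd t : (forall i, (a <= i < b)%N -> 0 <= W i) ->
  0 <= nmass a b nd t.
Proof.
by move=> W0; rewrite /nmass big_nat; apply: sumr_ge0 => i /W0 ?;
  rewrite mulrn_wge0.
Qed.

Lemma nmass_ge a b nd t i : (forall i, (a <= i < b)%N -> 0 <= W i) ->
  (a <= i < b)%N -> nd i \in t -> W i <= nmass a b nd t.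
Proof.
move=> W0 /andP[ai ib] it; rewrite /nmass (big_cat_nat (n := i)) //=;
  last exact: ltnW.
rewrite [in X in _ + X]big_ltn // it mulr1n.
have h1 : 0 <= nmass a i nd t.
  by apply: nmass_ge0 => j /andP[? ji]; apply: W0;
    rewrite (ltn_trans ji) ?andbT.
have h2 : 0 <= nmass i.+1 b nd t.
  by apply: nmass_ge0 => j /andP[ij ?]; apply: W0;
    rewrite (leq_trans ai) ?(ltnW ij).
by rewrite -/(nmass a i nd t) -/(nmass _ b nd t); lra.
Qed.

Lemma eq_nmass a b nd nd' t : (forall i, (a <= i < b)%N -> nd i = nd' i) ->
  nmass a b nd t = nmass a b nd' t.
Proof. by move=> e; apply: eq_big_nat => i /e->. Qed.

Lemma nmass0_notin a b nd x t1 t2 :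
  (forall i, (a <= i < b)%N -> nd i != x) ->
  nmass a b nd (t1 ++ x :: t2) = nmass a b nd (t1 ++ t2).
Proof.
by move=> e; apply: eq_big_nat => i /e/negPf ix; rewrite !mem_cat in_cons ix.
Qed.

Lemma dev_recl a b y : (a < b)%N -> dev a b y = W a * `|F a - y| + dev a.+1 b y.
Proof. by move=> ab; rewrite /dev big_ltn. Qed.

Lemma dev_recr a b y : (a <= b)%N -> dev a b.+1 y = dev a b y + W b * `|F b -
  y|.
Proof. by move=> ab; rewrite /dev big_nat_recr. Qed.

(** No datum lies strictly between [y] and [z], so each absolute value keeps its sign and the
    deviation is affine there. *)
Lemma dev_shift a b nd t1 t2 y z :
  y <= z -> uniq (t1 ++ t2) ->
  (forall i, (a <= i < b)%N -> nd i \in t1 ++ t2) ->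
  (forall i, (a <= i < b)%N -> nd i \in t1 -> F i <= y) ->
  (forall i, (a <= i < b)%N -> nd i \in t2 -> z <= F i) ->
  dev a b z = dev a b y + (z - y) * (nmass a b nd t1 - nmass a b nd t2).
Proof.
move=> yz; rewrite cat_uniq => /and3P[_ /hasPn t12 _] it h1 h2.
rewrite -sumrB mulr_sumr -big_split /=; apply: eq_big_nat => i ib.
have := it _ ib; rewrite mem_cat; case: (boolP (nd i \in t2)) => [i2 _|_].
  have /negPf-> := t12 _ i2; have zF := h2 _ ib i2; rewrite mulr1n mulr0n.
  rewrite !ger0_norm ?subr_ge0 ?(le_trans yz) //; ring.
rewrite orbF => i1; rewrite i1 mulr1n mulr0n; have Fy := h1 _ ib i1.
rewrite !ler0_norm ?subr_le0 ?(le_trans Fy) //; ring.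
Qed.

(** Convexity: to the right of [y] the deviation grows at least with the slope that counts [x] on
    the left, and to the left of [y] with the slope that counts [x] on the right. The two balance
    conditions make both slopes nonnegative. *)
Lemma dev_median a b nd s1 x s2 y z :
  (forall i, (a <= i < b)%N -> 0 <= W i) ->
  uniq (s1 ++ x :: s2) ->
  (forall i, (a <= i < b)%N -> nd i \in s1 ++ x :: s2) ->
  (forall i, (a <= i < b)%N -> nd i \in s1 -> F i <= y) ->
  (forall i, (a <= i < b)%N -> nd i = x -> F i = y) ->
  (forall i, (a <= i < b)%N -> nd i \in s2 -> y <= F i) ->
  nmass a b nd s1 <= nmass a b nd s2 + nmass a b nd [:: x] ->
  nmass a b nd s2 <= nmass a b nd s1 + nmass a b nd [:: x] ->
  dev a b y <= dev a b z.
Proof.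
move=> W0 us ms h1 hx h2 m1 m2; rewrite -subr_ge0.
have us' : uniq (x :: s2) by move: us; rewrite cat_uniq => /and3P[].
have us1 : uniq ((s1 ++ [:: x]) ++ s2) by rewrite -catA.
suff [H|H] : (0 <= (z - y) * (nmass a b nd (s1 ++ [:: x]) - nmass a b nd s2)
               <= dev a b z - dev a b y) \/
       (0 <= (y - z) * (nmass a b nd (x :: s2) - nmass a b nd s1)
               <= dev a b z - dev a b y).
  by case/andP: H => /le_trans H /H.
  by case/andP: H => /le_trans H /H.
have [yz|/ltW zy] := leP y z; [left | right]; apply/andP; split.
- apply: mulr_ge0; rewrite subr_ge0 // nmass_cat //.
  by move: us1; rewrite cat_uniq => /and3P[].
- rewrite -!sumrB mulr_sumr; apply: ler_sum_nat => i ib.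
  rewrite -mulrBr; have Wi := W0 _ ib; have := ms _ ib.
  move: us1; rewrite cat_uniq => /and3P[_ /hasPn us1 _].
  rewrite -cat1s catA mem_cat; case: (boolP (nd i \in s2)) => [i2 _|_].
    have /negPf-> := us1 _ i2; rewrite mulr1n mulr0n sub0r mulrN mulrC -mulrN
      ler_wpM2l //.
    by have := ler_distD z (F i) y; rewrite [`|z - y|]ger0_norm ?subr_ge0 //;
      lra.
  rewrite orbF => i1; rewrite i1 mulr1n mulr0n subr0 mulrC ler_wpM2l //.
  have Fy: F i <= y.
    move: i1; rewrite mem_cat mem_seq1 => /orP[/(h1 _ ib)//|/eqP/(hx _ ib)->//].
  by rewrite !ler0_norm ?subr_le0 ?(le_trans Fy) //; lra.
- by apply: mulr_ge0; rewrite subr_ge0 // nmass_cons // addrC.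
- rewrite -!sumrB mulr_sumr; apply: ler_sum_nat => i ib.
  rewrite -mulrBr; have Wi := W0 _ ib; have := ms _ ib.
  move: us; rewrite cat_uniq => /and3P[_ /hasPn us _].
  rewrite mem_cat; case: (boolP (nd i \in x :: s2)) => [i2 _|_].
    have /negPf-> := us _ i2; rewrite mulr1n mulr0n subr0 mulrC ler_wpM2l //.
    have Fy: y <= F i by move: i2; rewrite in_cons => /orP[/eqP/(hx _
      ib)->//|/(h2 _ ib)].
    by rewrite !ger0_norm ?subr_ge0 ?(le_trans zy) //; lra.
  rewrite orbF => i1; rewrite i1 mulr1n mulr0n sub0r mulrN mulrC -mulrN
    ler_wpM2l //.
  by have := ler_distD z (F i) y; rewrite [`|z - y|]ler0_norm ?subr_le0 //; lra.
Qed.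

End Deviation.

(** * Linked histograms of a block of data *)

Section Histogram.
Variables (R : realDomainType) (F W : nat -> R) (N : nat).
Implicit Types (a b c x y : nat) (s : seq nat).

Let Wpos a b := forall i, (a <= i < b)%N -> 0 < W i.

(* The histogram of the data with indices in [a, b), with node list s, next   *)
(* and previous pointers nx and pv, array I = nd, weights wt and values vl.   *)
Record hist a b s (nx pv nd : nat -> nat) (wt vl : nat -> \bar R) : Prop :=
  Hist {
  hist_next : chain nx s;
  hist_prev : chain pv (rev s);
  hist_sorted : sorted (fun x y => vl x < vl y)%E s;
  hist_range : {in s, forall x, (0 < x <= N)%N};
  hist_node : forall i, (a <= i < b)%N -> nd i \in s;
  hist_val : forall i, (a <= i < b)%N -> vl (nd i) = (F i)%:E;
  hist_onto : {in s, forall x, exists2 i, (a <= i < b)%N & nd i = x};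
  hist_wgt : {in s, forall x, wt x = (nmass W a b nd [:: x])%:E} }.

Variables (nx pv nd : nat -> nat) (wt vl : nat -> \bar R).
Variables (nx' pv' nd' : nat -> nat) (wt' vl' : nat -> \bar R).

Lemma hist_uniq a b s : hist a b s nx pv nd wt vl -> uniq (0%N :: s).
Proof.
move=> h; rewrite cons_uniq; apply/andP; split.
  by apply/negP => /(hist_range h).
apply: sorted_uniq (hist_sorted h).
  by move=> y x z; apply: lt_trans.
by move=> x; rewrite ltxx.
Qed.

Lemma hist_uniqs a b s : hist a b s nx pv nd wt vl -> uniq s.
Proof. by move/hist_uniq => /andP[]. Qed.

(** Pigeonhole on the node numbers; this bounds every traversal of the list. *)
Lemma hist_size a b s : hist a b s nx pv nd wt vl -> (size s <= N)%N.
Proof.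
move=> h; rewrite -[leqRHS](size_iota 1); apply: uniq_leq_size (hist_uniqs h) _.
by move=> x /(hist_range h); rewrite mem_iota add1n ltnS.
Qed.

Lemma eq_hist a b s :
  {in 0%N :: s, nx =1 nx'} -> {in 0%N :: s, pv =1 pv'} ->
  {in s, wt =1 wt'} -> hist a b s nx pv nd wt vl -> hist a b s nx' pv' nd wt'
    vl.
Proof.
move=> e1 e2 e3 [h1 h2 h3 h4 h5 h6 h7 h8]; split=> //.
- exact: eq_in_chain h1.
- apply: eq_in_chain h2 => x xs; apply: e2; move: xs.
  by rewrite !in_cons mem_rev.
- by move=> x xs; rewrite -e3 ?h8.
Qed.

Lemma hist_nextE a b s1 s2 : hist a b (s1 ++ s2) nx pv nd wt vl ->
  nx (last 0%N s1) = head 0%N s2.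
Proof. by move/hist_next/chain_next. Qed.

Lemma hist_prevE a b s1 s2 : hist a b (s1 ++ s2) nx pv nd wt vl ->
  pv (head 0%N s2) = last 0%N s1.
Proof.
move/hist_prev; rewrite rev_cat => /chain_next; case/lastP: s1 => [|s1 y];
  by case: s2 => [|x s2]; rewrite ?last_rcons ?rev_rcons ?rev_cons ?last_rcons.
Qed.

Lemma hist_ends a b s1 s2 : hist a b (s1 ++ s2) nx pv nd wt vl ->
  (last 0 s1 <= N)%N /\ (head 0 s2 <= N)%N.
Proof.
move/hist_range => rg; split.
  case/lastP: s1 rg => // s x /(_ x); rewrite last_rcons mem_cat mem_rcons
    mem_head.
  by case/(_ isT)/andP.
by case: s2 rg => //= x s /(_ x); rewrite mem_cat mem_head orbT => /(_
  isT)/andP[].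
Qed.

Lemma hist_pairwise a b s : hist a b s nx pv nd wt vl ->
  pairwise (fun x y => vl x < vl y)%E s.
Proof.
move/hist_sorted; rewrite sorted_pairwise //.
by move=> y x z; apply: lt_trans.
Qed.

Lemma hist_lt a b s1 s2 : hist a b (s1 ++ s2) nx pv nd wt vl ->
  {in s1 & s2, forall x y, (vl x < vl y)%E}.
Proof.
by move/hist_pairwise; rewrite pairwise_cat => /and3P[/allrelP].
Qed.

Lemma hist_lt1 a b s1 x s2 : hist a b (s1 ++ x :: s2) nx pv nd wt vl ->
  {in s1, forall y, (vl y < vl x)%E} /\ {in s2, forall y, (vl x < vl y)%E}.
Proof.
move=> h; split=> y ys; first by apply: (hist_lt h) => //; rewrite mem_head.
move: h; rewrite -cat1s catA => /hist_lt; apply=> //.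
by rewrite mem_cat mem_head orbT.
Qed.

Lemma hist_fin a b s x : hist a b s nx pv nd wt vl -> x \in s ->
  exists2 i, (a <= i < b)%N & nd i = x /\ vl x = (F i)%:E.
Proof.
by move=> h xs; have [i ib ix] := hist_onto h xs; exists i;
  rewrite -?ix ?(hist_val h).
Qed.

Lemma hist_nmass_rcons a b s1 x s2 : hist a b (s1 ++ x :: s2) nx pv nd wt vl ->
  nmass W a b nd (rcons s1 x) = nmass W a b nd s1 + nmass W a b nd [:: x].
Proof.
move/hist_uniqs; rewrite -cat_rcons cat_uniq => /and3P[u _ _].
by rewrite -cats1 nmass_cat ?cats1.
Qed.

Lemma hist_nmass_cons a b s1 x s2 : hist a b (s1 ++ x :: s2) nx pv nd wt vl ->
  nmass W a b nd (x :: s2) = nmass W a b nd [:: x] + nmass W a b nd s2.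
Proof. by move/hist_uniqs; rewrite cat_uniq => /and3P[_ _ /nmass_cons->]. Qed.

Lemma hist_mem_range a b s1 x s2 : hist a b (s1 ++ x :: s2) nx pv nd wt vl ->
  (0 < x <= N)%N.
Proof. by move/hist_range; apply; rewrite mem_cat mem_head orbT. Qed.

Lemma hist_mem_wgt a b s1 x s2 : hist a b (s1 ++ x :: s2) nx pv nd wt vl ->
  wt x = (nmass W a b nd [:: x])%:E.
Proof. by move/hist_wgt; apply; rewrite mem_cat mem_head orbT. Qed.

Lemma hist_nil a : chain nx [::] -> chain pv [::] -> hist a a [::] nx pv nd wt
  vl.
Proof.
move=> n0 p0; split=> // i; first by rewrite ltnNge andbN.
by rewrite ltnNge andbN.
Qed.

Lemma nmass1_gt0 a b x : Wpos a b -> (exists2 i, (a <= i < b)%N & nd i = x) ->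
  0 < nmass W a b nd [:: x].
Proof.
move=> W0 [i ib ix]; apply: lt_le_trans (W0 i ib) _.
by apply: nmass_ge => //; [move=> j /W0/ltW | rewrite ix mem_head].
Qed.

Lemma hist_mass_gt0 a b s x t : Wpos a b -> hist a b s nx pv nd wt vl ->
  x \in s -> x \in t -> 0 < nmass W a b nd t.
Proof.
move=> W0 h xs xt; have [i ib ix] := hist_onto h xs.
by apply: lt_le_trans (W0 i ib) _; apply: nmass_ge; rewrite ?ix // => j /W0/ltW.
Qed.

(** Positivity of the weights is what makes the test for weight 0 detect an empty node. *)
Lemma nmass1_eq0 a b x : Wpos a b -> nmass W a b nd [:: x] = 0 ->
  forall i, (a <= i < b)%N -> nd i != x.
Proof.
move=> W0 m0 i ib; apply/eqP => ix.
have: 0 < nmass W a b nd [:: x] by apply: nmass1_gt0 => //; exists i.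
by rewrite m0 ltxx.
Qed.

Lemma nmass1_neq0 a b x : nmass W a b nd [:: x] != 0 ->
  exists2 i, (a <= i < b)%N & nd i = x.
Proof.
move=> m0; have: has (fun i => nd i == x) (index_iota a b).
  apply: contraNT m0 => /hasPn m0; rewrite /nmass big_nat big1_seq // => i.
  rewrite mem_seq1 => /andP[ib _].
  by rewrite (negPf (m0 i _)) ?mem_index_iota // mulr0n.
by case/hasP => i; rewrite mem_index_iota => ib /eqP; exists i.
Qed.

Lemma nmass_add a b t x : (a <= b)%N ->
  (forall i, nd' i = if i == b then x else nd i) ->
  nmass W a b.+1 nd' t = nmass W a b nd t + W b *+ (x \in t).
Proof.
move=> ab e; rewrite nmass_recr // e eqxx; congr (_ + _).
by apply: eq_nmass => i /andP[_ ib]; rewrite e ltn_eqF.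
Qed.

Lemma hist_add_old a b s x : (a <= b)%N ->
  hist a b s nx pv nd wt vl -> x \in s -> vl x = (F b)%:E ->
  (forall i, nd' i = if i == b then x else nd i) ->
  (forall y, wt' y = if y == x then (wt x + (W b)%:E)%E else wt y) ->
  hist a b.+1 s nx pv nd' wt' vl.
Proof.
move=> ab [h1 h2 h3 h4 h5 h6 h7 h8] xs xb en ew; split=> //.
- move=> i; rewrite en ltnS [(i <= b)%N]leq_eqVlt; case: eqP => //= _;
  exact: h5.
- move=> i; rewrite en ltnS [(i <= b)%N]leq_eqVlt; case: eqP => //= [-> //|_];
  exact: h6.
- move=> y /h7[i /andP[ai ib] iy]; exists i; first by rewrite ai ltnS ltnW.
  by rewrite en ltn_eqF.
- move=> y ys; rewrite (nmass_add _ ab en) ew mem_seq1 eq_sym.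
  by case: eqP => [->|_]; rewrite ?mulr0n ?addr0 h8 // ?mulr1n -EFinD.
Qed.

(** When [s1] or [s2] is empty the neighbour is the header 0, so insertion at an end of the list is
    not a separate case. *)
Lemma hist_add_new a b s1 s2 c : (a <= b)%N ->
  hist a b (s1 ++ s2) nx pv nd wt vl -> c \notin s1 ++ s2 -> (0 < c <= N)%N ->
  {in s1, forall y, (vl y < (F b)%:E)%E} -> {in s2, forall y, ((F b)%:E < vl
    y)%E} ->
  nx' c = head 0%N s2 -> nx' (last 0%N s1) = c ->
  (forall y, y != c -> y != last 0%N s1 -> nx' y = nx y) ->
  pv' c = last 0%N s1 -> pv' (head 0%N s2) = c ->
  (forall y, y != c -> y != head 0%N s2 -> pv' y = pv y) ->
  (forall i, nd' i = if i == b then c else nd i) ->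
  (forall y, wt' y = if y == c then (W b)%:E else wt y) ->
  (forall y, vl' y = if y == c then (F b)%:E else vl y) ->
  hist a b.+1 (s1 ++ c :: s2) nx' pv' nd' wt' vl'.
Proof.
move=> ab h cs cN lt1 lt2 n1 n2 n3 p1 p2 p3 en ew ev.
have pc : perm_eq (s1 ++ c :: s2) (c :: s1 ++ s2) by rewrite perm_catC /=
  perm_cons perm_catC.
have u : uniq (0%N :: s1 ++ c :: s2).
  have := hist_uniq h; rewrite !cons_uniq (perm_uniq pc) (perm_mem pc) /=
    in_cons.
  by move=> /andP[/negPf-> ->]; rewrite cs orbF andbT; case/andP: cN; case: (c).
have evs y : y \in s1 ++ s2 -> vl' y = vl y.
  by move=> ys; rewrite ev; case: eqP => // yc; rewrite -yc ys in cs.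
have pw t : {subset t <= s1 ++ s2} -> pairwise (fun x y => vl x < vl y)%E t ->
    pairwise (fun x y => vl' x < vl' y)%E t.
  move=> ts; apply: (@sub_in_pairwise _ (mem t)); last exact/allP.
  by move=> x y /= /ts xs /ts ys; rewrite !evs.
split.
- by apply: (chain_insert u (hist_next h)).
(* In the reversed list the two neighbours of [c] exchange their roles. *)
- have hl : last 0%N (rev s2) = head 0%N s2 by case: (s2) => //= x s;
  rewrite rev_cons last_rcons.
  have hr : head 0%N (rev s1) = last 0%N s1 by case/lastP: (s1) => //= s x;
    rewrite rev_rcons last_rcons.
  rewrite rev_cat rev_cons cat_rcons; apply: (@chain_insert pv);
    rewrite ?hl ?hr //.
  + by move: u; rewrite !cons_uniq -rev_uniq -mem_rev rev_cat rev_cons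
    cat_rcons.
  + by rewrite -rev_cat; apply: hist_prev h.
- have tr : transitive (fun x y => vl' x < vl' y)%E by move=> y x z;
  apply: lt_trans.
  rewrite sorted_pairwise // pairwise_cat pairwise_cons.
  have := hist_pairwise h; rewrite pairwise_cat => /and3P[/allrelP r1 r2 r3].
  apply/and4P; split.
  + apply/allrelP => x y xs; rewrite in_cons (evs x) ?mem_cat ?xs // =>
    /orP[/eqP->|ys].
      by rewrite ev eqxx lt1.
    by rewrite (evs y) ?mem_cat ?ys ?orbT // r1.
  + by apply: pw r2 => y ys; rewrite mem_cat ys.
  + apply/allP => y ys; rewrite (evs y) ?mem_cat ?ys ?orbT //.
    by rewrite ev eqxx lt2.
  + by apply: pw r3 => y ys; rewrite mem_cat ys orbT.
- move=> y; rewrite (perm_mem pc) in_cons => /orP[/eqP->//|];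
  exact: hist_range h y.
- move=> i; rewrite en ltnS [(i <= b)%N]leq_eqVlt (perm_mem pc) in_cons;
  case: (i =P b) => [_|_] //=.
    by rewrite eqxx.
  by move=> ib; rewrite (hist_node h ib) orbT.
- move=> i; rewrite en ltnS [(i <= b)%N]leq_eqVlt; case: (i =P b) => [->|_] /=.
    by rewrite ev eqxx.
  by move=> ib; rewrite evs ?(hist_node h) ?(hist_val h).
- move=> y; rewrite (perm_mem pc) in_cons => /orP[/eqP->|ys].
    by exists b; rewrite ?ab ?leqnn // en eqxx.
  have [i /andP[ai ib] iy] := hist_onto h ys; exists i;
    first by rewrite ai ltnS ltnW.
  by rewrite en ltn_eqF.
- move=> y; rewrite (nmass_add _ ab en) ew mem_seq1 (perm_mem pc) in_cons [c ==
  y]eq_sym.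
  case: (y =P c) => [->|_] /=; last by rewrite mulr0n addr0 => /(hist_wgt h)->.
  move=> _; rewrite /nmass big_nat big1 ?mulr1n ?add0r // => i ib.
  rewrite mem_seq1; case: eqP => // ic; move: cs; rewrite -ic.
  by rewrite (hist_node h ib).
Qed.

Lemma hist_remove_keep a b s x : (a < b)%N ->
  hist a b s nx pv nd wt vl -> nd a = x -> nmass W a.+1 b nd [:: x] != 0 ->
  (forall y, wt' y = if y == x then (wt x - (W a)%:E)%E else wt y) ->
  hist a.+1 b s nx pv nd wt' vl.
Proof.
move=> ab h ax mx ew; case: (h) => [h1 h2 h3 h4 h5 h6 h7 h8]; split=> //.
- by move=> i /andP[ai ib]; rewrite h5 // ltnW.
- by move=> i /andP[ai ib]; rewrite h6 // ltnW.
- move=> y /h7[i /andP[]]; rewrite leq_eqVlt => /orP[/eqP<- _ <-|ai ib iy].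
    by rewrite ax; apply: nmass1_neq0.
  by exists i; rewrite ?ai.
- move=> y ys; rewrite ew; case: eqP => [yx|/eqP yx]; last first.
    by rewrite h8 // nmass_recl // ax mem_seq1 eq_sym (negPf yx) mulr0n add0r.
  by rewrite -yx h8 // nmass_recl // ax mem_seq1 yx eqxx mulr1n -EFinN -EFinD
    addrAC subrr add0r.
Qed.

(** No remaining datum refers to [x], so bypassing it loses nothing; the pointers out of [x] itself
    stay as they were. *)
Lemma hist_remove_drop a b s1 s2 x : (a < b)%N -> Wpos a.+1 b ->
  hist a b (s1 ++ x :: s2) nx pv nd wt vl -> nd a = x ->
  nmass W a.+1 b nd [:: x] = 0 ->
  nx' (last 0%N s1) = head 0%N s2 ->
  (forall y, y != last 0%N s1 -> nx' y = nx y) ->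
  pv' (head 0%N s2) = last 0%N s1 ->
  (forall y, y != head 0%N s2 -> pv' y = pv y) ->
  (forall y, y != x -> wt' y = wt y) ->
  hist a.+1 b (s1 ++ s2) nx' pv' nd wt' vl.
Proof.
move=> ab W0 h ax /(nmass1_eq0 W0) mx n1 n2 p1 p2 ew.
have u := hist_uniq h.
have sub y : y \in s1 ++ s2 -> y \in s1 ++ x :: s2.
  by rewrite !mem_cat in_cons => /orP[]->; rewrite ?orbT.
have nex y : y \in s1 ++ s2 -> y != x.
  move=> ys; apply: contraTneq ys => ->; move: u; rewrite cons_uniq => /andP[_].
  by rewrite uniq_catC cat_cons cons_uniq !mem_cat orbC => /andP[].
case: (h) => [h1 h2 h3 h4 h5 h6 h7 h8]; split.
- exact: (chain_remove u h1).
- have hl : last 0%N (rev s2) = head 0%N s2 by case: (s2) => //= z s;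
  rewrite rev_cons last_rcons.
  have hr : head 0%N (rev s1) = last 0%N s1 by case/lastP: (s1) => //= s z;
    rewrite rev_rcons last_rcons.
  rewrite rev_cat; apply: (@chain_remove pv _ _ x); rewrite ?hl ?hr //.
  + by move: u; rewrite !cons_uniq -rev_uniq -mem_rev rev_cat rev_cons
    cat_rcons.
  + by move: h2; rewrite rev_cat rev_cons cat_rcons.
- apply: subseq_sorted h3; first by move=> ? ? ?; apply: lt_trans.
  by rewrite cat_subseq //; apply: subseq_cons.
- by move=> y /sub/h4.
- move=> i /andP[ai ib]; have := h5 i; rewrite ltnW // ib => /(_ isT).
  by rewrite !mem_cat in_cons (negPf (mx i _)) // ai.
- by move=> i /andP[ai ib]; rewrite h6 // ltnW.
- move=> y ys; have [i /andP[]] := h7 _ (sub _ ys).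
  rewrite leq_eqVlt => /orP[/eqP<- _ ay|ai ib iy]; last by exists i;
    rewrite ?ai.
  by move: (nex _ ys); rewrite -ay ax eqxx.
- move=> y ys; rewrite ew ?nex // h8 ?sub // nmass_recl //.
  by rewrite ax mem_seq1 eq_sym (negPf (nex _ ys)) mulr0n add0r.
Qed.

End Histogram.

(** * Optimal segmentations *)

Section Segmentation.
Variables (R : realDomainType) (F W : nat -> R) (gamma : R).
Implicit Types (v : nat -> R) (p : nat -> R).

(** Position i stands for the gap between i and i + 1, so the entries concerned are a, ..., b,
    whereas [misfit a b] stops at b - 1. Hence the pairing of [penalty 1 n] with [misfit 1 n.+1]. *)
Definition penalty a b v : R := gamma * (\sum_(a <= i < b) (v i != v i.+1))%:R.

Definition misfit a b v : R := \sum_(a <= i < b) W i * `|F i - v i|.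

Lemma penalty_recr a b v : (a <= b)%N ->
  penalty a b.+1 v = penalty a b v + gamma * (v b != v b.+1)%:R.
Proof. by move=> ab; rewrite /penalty big_nat_recr //= natrD mulrDr. Qed.

Lemma misfit_recr a b v : (a <= b)%N ->
  misfit a b.+1 v = misfit a b v + W b * `|F b - v b|.
Proof. by move=> ab; rewrite /misfit big_nat_recr. Qed.

Lemma misfit_const a b v y : (forall i, (a <= i < b)%N -> v i = y) ->
  misfit a b v = dev F W a b y.
Proof. by move=> e; apply: eq_big_nat => i /e->. Qed.

Lemma segmentation_lower p n v :
  p 0%N = - gamma ->
  (forall r l y, (0 < l <= r)%N -> (r <= n)%N ->
     p r <= p l.-1 + gamma + dev F W l r.+1 y) ->
  (0 < n)%N -> p n <= penalty 1 n v + misfit 1 n.+1 v.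
Proof.
move=> p0 pr n0.
(* Strengthened for the induction: [l] starts a block ending at [r] on which [v] is constant, and
   the block is kept open with its own term [dev]. Reaching r + 1 either prolongs the block or
   closes it by the hypothesis on [p] and opens a new one. *)
suff H r : (0 < r <= n)%N -> exists l, [/\ (0 < l <= r)%N,
    forall i, (l <= i <= r)%N -> v i = v r &
    p l.-1 + gamma + dev F W l r.+1 (v r) <= penalty 1 r v + misfit 1 r.+1 v].
  by have [|l [lr _ /(le_trans (pr n l (v n) lr (leqnn n)))]] := H n;
    first by rewrite n0 /=.
elim: r => // -[_ _|r IHr /andP[_ rn]].
  exists 1%N; split=> //; first by move=> i; rewrite -eqn_leq => /eqP->.
  by rewrite p0 /penalty /misfit /dev big_geq // mulr0 !big_nat1 addNr.
have [|l [/andP[l0 lr] vl le]] := IHr; first exact: ltnW.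
rewrite penalty_recr // misfit_recr //.
case: eqP => vr; rewrite ?mulr0 ?mulr1 ?addr0.
  exists l; split; first by rewrite l0 leqW.
    by move=> i /andP[li]; rewrite leq_eqVlt => /orP[/eqP->//|ir];
      rewrite vl ?li.
  rewrite dev_recr; last by rewrite leqW.
  by rewrite -vr; move: le => /=; lra.
exists r.+2; split; first by rewrite leqnn.
  by move=> i; rewrite -eqn_leq => /eqP->.
rewrite dev_recr // [dev F W r.+2 r.+2 _]big_geq //= add0r.
have := pr r.+1 l (v r.+1); rewrite l0 lr (ltnW rn) => /(_ isT isT).
by move: le => /=; lra.
Qed.

Lemma eq_misfit a b v v' : (forall i, (a <= i < b)%N -> v i = v' i) ->
  misfit a b v = misfit a b v'.
Proof. by move=> e; apply: eq_big_nat => i /e->. Qed.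

Lemma penalty_const a b v y : (forall i, (a <= i <= b)%N -> v i = y) ->
  penalty a b v = 0.
Proof.
move=> e; rewrite /penalty big_nat big1 ?mulr0 // => i /andP[ai ib].
by rewrite !e ?eqxx ?ai ?(ltnW ib) // ltnW.
Qed.

(** Prepending a block creates at most one jump, and none if nothing follows. It is an inequality
    because neighbouring blocks may carry the same value. *)
Lemma segmentation_step a b n v v' y : 0 <= gamma -> (a < b <= n)%N ->
  (forall i, (a < i <= b)%N -> v' i = y) ->
  (forall i, (b < i <= n)%N -> v' i = v i) ->
  misfit a.+1 n.+1 v' + penalty a.+1 n v' <=
  dev F W a.+1 b.+1 y + gamma * (b < n)%:R + (misfit b.+1 n.+1 v + penalty b.+1
    n v).
Proof.
move=> g0 /andP[ab bn] e1 e2.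
have -> : misfit a.+1 n.+1 v' = dev F W a.+1 b.+1 y + misfit b.+1 n.+1 v.
  rewrite -(misfit_const (v := v') (y := y)) // -(eq_misfit (v := v')) //.
  by rewrite /misfit -big_cat_nat // ltnW.
suff : penalty a.+1 n v' <= gamma * (b < n)%:R + penalty b.+1 n v by lra.
move: bn; rewrite leq_eqVlt => /orP[/eqP bn|bn].
  rewrite -bn ltnn mulr0 add0r (penalty_const (y := y)) //.
  by rewrite /penalty big_geq ?mulr0.
have -> : penalty a.+1 n v' = penalty a.+1 b v' + gamma * (v' b != v' b.+1)%:R
  + penalty b.+1 n v'.
  rewrite /penalty -!mulrDr -!natrD; congr (_ * _%:R).
  rewrite (big_cat_nat (n := b)) //=; last exact: ltnW.
  by rewrite [in X in (_ + X)%N]big_ltn // addnA.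
rewrite (penalty_const (y := y)); last first.
  by move=> i /andP[ai ib]; rewrite e1 // ai.
rewrite add0r lerD //; first by rewrite bn ler_wpM2l // ler_nat leq_b1.
rewrite /penalty ler_wpM2l // ler_nat; apply: eq_leq.
by apply: eq_big_nat => i /andP[bi i_n];
  rewrite !e2 ?bi ?(ltnW bi) ?(leqW bi) // ltnW.
Qed.

End Segmentation.

(** * Specifications of the parts of the program *)

Section Specs.
Variables (R : realDomainType) (F W : nat -> R) (gamma : R) (N : nat).
Implicit Types (m : memory R) (a b x y : nat) (s : seq nat).

(** * Invariants of the memory *)

Record sane m : Prop := Sane {
  sane_isize (q : iarr) : size (iheap m q) = N.+1;
  sane_rsize (q : rarr) : size (rheap m q) = N.+1;
  sane_pos i : (0 < i <= N)%N -> 0 < W i;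
  sane_N : ireg m vN = N;
  sane_gamma : rreg m vGamma = gamma%:E;
  sane_F i : (0 < i <= N)%N -> nth 0%E (rheap m aF) i = (F i)%:E;
  sane_W i : (0 < i <= N)%N -> nth 0%E (rheap m aW) i = (W i)%:E }.

Definition keeps_input c : bool :=
  [&& alloc_free c, ~~ writes_ireg c vN, ~~ writes_rreg c vGamma,
      ~~ writes_rheap c aF & ~~ writes_rheap c aW].

Lemma sane_frame c m m' : frame c m m' -> keeps_input c -> sane m -> sane m'.
Proof.
move=> [f1 f2 f3 f4 f5 f6] /and5P[c1 c2 c3 c4 c5] [s1 s2 s3 s4 s5 s6 s7].
by split=> [a|a|i|||i|i]; rewrite ?f5 ?f6 ?f1 ?f2 ?f4 //;
  [apply: s3|apply: s6|apply: s7].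
Qed.

Definition phist a b s m :=
  hist F W N a b s (nth 0%N (iheap m aNext)) (nth 0%N (iheap m aPrev))
    (nth 0%N (iheap m aNode)) (nth 0%E (rheap m aWgt)) (nth 0%E (rheap m aVal)).

Definition thist a b s m :=
  hist F W N a b s (nth 0%N (iheap m aTNext)) (nth 0%N (iheap m aTPrev))
    (nth 0%N (iheap m aNode)) (nth 0%E (rheap m aTWgt)) (nth 0%E (rheap m
      aVal)).

(** The nodes in use are numbered 1, ..., c without gaps, so c + 1 is fresh; c < b keeps it within
    the arrays as long as b is at most [N]. *)
Definition full_hist a b m := exists s,
  [/\ phist a b s m, perm_eq s (iota 1 (ireg m vC)) & (ireg m vC < b)%N].

Lemma phist_frame c a b s m m' : frame c m m' ->
  [&& ~~ writes_iheap c aNext, ~~ writes_iheap c aPrev, ~~ writes_iheap c aNode,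
      ~~ writes_rheap c aWgt & ~~ writes_rheap c aVal] ->
  phist a b s m -> phist a b s m'.
Proof.
move=> fr /and5P[c1 c2 c3 c4 c5]; rewrite /phist.
by rewrite !(frame_iheap fr) // !(frame_rheap fr).
Qed.

Lemma thist_frame c a b s m m' : frame c m m' ->
  [&& ~~ writes_iheap c aTNext, ~~ writes_iheap c aTPrev, ~~ writes_iheap c
    aNode,
      ~~ writes_rheap c aTWgt & ~~ writes_rheap c aVal] ->
  thist a b s m -> thist a b s m'.
Proof.
move=> fr /and5P[c1 c2 c3 c4 c5]; rewrite /thist.
by rewrite !(frame_iheap fr) // !(frame_rheap fr).
Qed.

(** * Building the histogram and finding a first median *)

Lemma insert_spec i a b m : sane m -> i != vX -> i != vC -> ireg m i = b ->
  (0 < a <= b)%N -> (b <= N)%N -> full_hist a b m ->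
  runs (insert i) m (30 * N + 100) (full_hist a b.+1).
Proof.
move=> sm iX iC mi /andP[a0 ab] bN [s [h pm cb]].
have u := hist_uniq h.
have sN := hist_size h.
apply: (runs_seq (T1 := 10) (T2 := (30 * N + 90)%N) (Q1 := fun m' => ireg m' vX
  = head 0%N s)); last by lia.
  apply: runs_wp => //=; rewrite sane_isize //; split=> //.
  exact: (hist_nextE (s1 := [::]) h).
move=> m1 fr1 X1.
have sm1 := sane_frame fr1 isT sm.
have h1 := phist_frame fr1 isT h.
apply: (runs_seq (T1 := (20 * N + 20)%N) (T2 := 70%N) (Q1 := fun m' => exists
  s1 s2,
  [/\ s = s1 ++ s2, ireg m' vX = head 0%N s2,
     {in s1, forall y, (nth 0%E (rheap m aVal) y < (F b)%:E)%E} &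
     s2 <> [::] -> ((F b)%:E <= nth 0%E (rheap m aVal) (head 0%N s2))%E]));
       last by lia.
  apply: (runs_while (B := 10) (k := size s) (I := fun k m' => exists s1 s2,
    [/\ k = size s2, s = s1 ++ s2, ireg m' vX = head 0%N s2 &
     {in s1, forall y, (nth 0%E (rheap m aVal) y < (F b)%:E)%E}])).
  - by exists [::], s.
  - move=> k m2 fr2 [s1 [s2 [ks es X2 lt2]]].
    have sm2 := sane_frame fr2 isT sm1.
    have h2 := phist_frame fr2 isT h1.
    have iE : ireg m2 i = b.
      rewrite (frame_ireg fr2) /= ?(negPf iX) // (frame_ireg fr1) /= ?(negPf
        iX) //.
    have eV : rheap m2 aVal = rheap m aVal.
      by rewrite (frame_rheap fr2) // (frame_rheap fr1).
    case: s2 ks es X2 => [|x s2] ks es X2 /=; rewrite X2 /=.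
      by split=> //; exists s1, [::].
    have xs : x \in s by rewrite es mem_cat mem_head orbT.
    have /andP[x0 xN] := hist_range h xs.
    rewrite -lt0n x0 /= !sane_rsize // ltnS xN iE ltnS bN eV sane_F ?bN
      ?(leq_trans a0) //.
    split=> //; case: ltP => [lt|ge]; last first.
      by exists s1, (x :: s2).
    apply: runs_wp => //=; rewrite X2 sane_isize // ltnS xN; split=> //.
    exists (size s2); first by rewrite ks.
    exists (rcons s1 x), s2; split=> //; first by rewrite cat_rcons.
      rewrite es -cat_rcons in h2.
      by rewrite -(hist_nextE h2) last_rcons.
    by move=> y; rewrite mem_rcons in_cons => /orP[/eqP->|/lt2].
  - by move: sN => /=; lia.
move=> m2 fr2 [s1 [s2 [es X2 lt2 ge2]]].
have sm2 := sane_frame fr2 isT sm1.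
have h2 := phist_frame fr2 isT h1.
have iE : ireg m2 i = b.
  by rewrite (frame_ireg fr2) /= ?(negPf iX) // (frame_ireg fr1) /= ?(negPf iX).
have eV : rheap m2 aVal = rheap m aVal.
  by rewrite (frame_rheap fr2) // (frame_rheap fr1).
have eC : ireg m2 vC = ireg m vC.
  by rewrite (frame_ireg fr2) // (frame_ireg fr1).
have b0 : (0 < b)%N by apply: leq_trans ab.
rewrite es in h h2; have [lN xN] := hist_ends h.
have px := hist_prevE h2.
apply: runs_wp => //=.
rewrite X2 iE eC (negPf iX) (negPf iC) !sane_rsize // !ltnS xN bN implybT;
  split=> //.
rewrite eV sane_F ?b0 //; case: ifPn => [/andP[x0 xb]|new].
  rewrite sane_isize // ltnS bN; do 2!split=> //.
  move/eqP in xb; have xs : head 0%N s2 \in s1 ++ s2.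
    by case: (s2) x0 => //= x t _; rewrite mem_cat mem_head orbT.
  exists (s1 ++ s2); split; rewrite /= ?eC -?es //; last exact: leqW.
  rewrite es; apply: (hist_add_old _ h2 xs) => //=; first by rewrite eV.
    by move=> j; rewrite nth_set_nth.
  by move=> y; rewrite nth_set_nth /= sane_W ?b0.
set c := (_ + 1)%N; have cN : (0 < c <= N)%N by rewrite /c; lia.
have cs : c \notin s1 ++ s2 by rewrite -es (perm_mem pm) mem_iota /c; lia.
(* The new node differs from both neighbours. Hence writing its own pointers does not spoil the
   later reading of [aPrev.[vX]], and the update of its predecessor does not overwrite its next
   pointer. *)
have xc : (head 0%N s2 == c) = false.
  apply/eqP => xc; case/negP: cs; rewrite -xc.
  by case: (s2) xc => [|x t] /= xc; [move: cN;
    rewrite -xc | rewrite mem_cat mem_head orbT].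
have cl : (c == last 0%N s1) = false.
  apply/eqP => cl; case/negP: cs; rewrite cl.
  case/lastP: (s1) cl => [|t x] /=; first by move=> e; move: cN; rewrite e.
  by rewrite last_rcons mem_cat mem_rcons mem_head.
have e1 : maxn c.+1 N.+1 = N.+1 by apply/maxn_idPr; rewrite ltnS; case/andP: cN.
rewrite !size_set_nth !sane_isize // nth_set_nth /= xc px e1 !ltnS.
case/andP: (cN) => _ ->; rewrite xN lN bN; do 9!split=> //.
exists (s1 ++ c :: s2); split=> /=; last by rewrite /c addn1.
  apply: (hist_add_new ab h2 cs cN) => /=.
  - by rewrite eV.
  - move=> y ys2; case: (s2) ys2 h2 new ge2 => // x t ys2 h2 new ge2.
    have lx : ((F b)%:E < nth 0%E (rheap m2 aVal) x)%E.
      rewrite eV lt_neqAle ge2 // andbT; move: new;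
        rewrite /= negb_and negbK [(F b)%:E == _]eq_sym.
      case/orP=> [/eqP x0|//]; have := hist_uniq h2.
      by rewrite cons_uniq x0 mem_cat mem_head orbT.
    move: ys2; rewrite in_cons => /orP[/eqP->//|yt].
    by apply: lt_trans lx _; apply: (hist_lt1 h2).2.
  - by rewrite !nth_set_nth /= cl nth_set_nth /= eqxx.
  - by rewrite nth_set_nth /= eqxx.
  - by move=> y yc yl; rewrite nth_set_nth /= (negPf yl) nth_set_nth /= (negPf
    yc).
  - by rewrite nth_set_nth /= eq_sym xc nth_set_nth /= eqxx.
  - by rewrite nth_set_nth /= eqxx.
  - by move=> y yc yl; rewrite nth_set_nth /= (negPf yl) nth_set_nth /= (negPf
    yc).
  - by move=> j; rewrite nth_set_nth.
  - by move=> y; rewrite nth_set_nth /= sane_W ?b0.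
  - by move=> y; rewrite nth_set_nth /= eV.
rewrite es in pm; have -> : iota 1 c = rcons (iota 1 (ireg m vC)) c.
  by rewrite /c iotaD -cats1 addn1.
by rewrite -[c :: s2]cat1s perm_catCA cat1s perm_sym perm_rcons perm_cons
  perm_sym.
Qed.

Lemma reset_spec a b s m : sane m -> phist a b s m ->
  runs reset_temporary m (40 * N + 100) (thist a b s).
Proof.
move=> sm h; have sN := hist_size h.
have nh := hist_nextE (s1 := [::]) h.
do 2 apply: runs_assoc.
apply: (@runs_seq _ _ _ _ 20 (40 * N + 50) _ (fun m' =>
  [/\ nth 0%N (iheap m' aTNext) 0 = nth 0%N (iheap m aNext) 0,
     nth 0%N (iheap m' aTPrev) 0 = nth 0%N (iheap m aPrev) 0 &
     ireg m' vX = head 0%N s])); last by lia.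
  apply: runs_wp => //=; rewrite !(sane_isize sm); do 3!split=> //.
  by rewrite !nth_set_nth nh.
move=> m1 fr1 [n1 p1 X1].
have sm1 := sane_frame fr1 isT sm.
have h1 := phist_frame fr1 isT h.
(* Pointers agree on [0 :: s1], header included; weights only on [s1]. *)
apply: (runs_while (B := 30) (k := size s) (I := fun k m' => exists s1 s2,
  [/\ k = size s2, s = s1 ++ s2, ireg m' vX = head 0%N s2,
    {in 0%N :: s1, forall y,
       nth 0%N (iheap m' aTNext) y = nth 0%N (iheap m aNext) y /\
       nth 0%N (iheap m' aTPrev) y = nth 0%N (iheap m aPrev) y} &
    {in s1, forall y, nth 0%E (rheap m' aTWgt) y = nth 0%E (rheap m aWgt) y}]));
  last by move: sN => /=; lia.
  by exists [::], s; split=> // y; rewrite mem_seq1 => /eqP->.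
move=> k m2 fr2 [s1 [s2 [ks es X2 np2 w2]]].
have sm2 := sane_frame fr2 isT sm1.
have h2 := phist_frame fr2 isT h1.
have eN : iheap m2 aNext = iheap m aNext.
  by rewrite (frame_iheap fr2) // (frame_iheap fr1).
have eP : iheap m2 aPrev = iheap m aPrev.
  by rewrite (frame_iheap fr2) // (frame_iheap fr1).
have eW : rheap m2 aWgt = rheap m aWgt.
  by rewrite (frame_rheap fr2) // (frame_rheap fr1).
case: s2 ks es X2 => [|x s2] ks es X2 /=; rewrite X2 /=.
  split=> //; rewrite cats0 in es; rewrite es in h2 *.
  apply: eq_hist h2 => [y|y|y]; rewrite ?eN ?eP ?eW.
  - by case/np2=> ->.
  - by case/np2=> _ ->.
  - by move/w2->.
have xs : x \in s by rewrite es mem_cat mem_head orbT.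
have /andP[x0 xN] := hist_range h xs.
rewrite -lt0n x0; split=> //; apply: runs_wp => //=.
rewrite X2 /= eN eP eW !(sane_isize sm, sane_isize sm2, sane_rsize sm,
  sane_rsize sm2) !ltnS xN; do 4!split=> //.
exists (size s2); first by rewrite ks.
exists (rcons s1 x), s2; split=> //; first by rewrite cat_rcons.
- rewrite /=; rewrite es -cat_rcons in h.
  by rewrite -(hist_nextE h) last_rcons.
- move=> y; rewrite /= !nth_set_nth /= -rcons_cons mem_rcons in_cons.
  by case: eqP => [->|_ /np2].
- by move=> y; rewrite /= !nth_set_nth /= mem_rcons in_cons;
  case: eqP => [->|_ /w2].
Qed.

Definition mass m a b t : R := nmass W a b (nth 0%N (iheap m aNode)) t.

Lemma mass_frame c m m' a b t : frame c m m' -> ~~ writes_iheap c aNode ->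
  mass m' a b t = mass m a b t.
Proof. by move=> fr cN; rewrite /mass (frame_iheap fr). Qed.

Lemma mass_nil m a b : mass m a b [::] = 0.
Proof. exact: nmass_nil. Qed.

Definition cursor a b s1 x s2 m : Prop :=
  [/\ thist a b (s1 ++ x :: s2) m, ireg m vM = x,
      rreg m vWl = (mass m a b s1)%:E & rreg m vWr = (mass m a b s2)%:E].

(** Neither side exceeds half of the total weight, with the total eliminated. *)
Definition median_cursor a b m : Prop := exists s1 x s2,
  [/\ cursor a b s1 x s2 m,
      mass m a b s1 <= mass m a b s2 + mass m a b [:: x] &
      mass m a b s2 <= mass m a b s1 + mass m a b [:: x]].

Lemma sane_gt0 m a b : sane m -> (0 < a)%N -> (b <= N.+1)%N ->
  forall i, (a <= i < b)%N -> 0 < W i.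
Proof.
move=> sm a0 bN i /andP[ai ib]; apply: (sane_pos sm).
by rewrite (leq_trans a0 ai) -ltnS (leq_trans ib).
Qed.

Lemma mass_ge0 m m' a b t : sane m -> (0 < a)%N -> (b <= N.+1)%N ->
  0 <= mass m' a b t.
Proof. by move=> sm a0 bN; apply: nmass_ge0 => i /(sane_gt0 sm a0 bN)/ltW. Qed.

(** One half of the balance is the invariant of the search: a step is taken only if the left side
    together with M is lighter than the right side, which is the same half for the next node. The
    failing guard is the other half. *)
Lemma find_median_spec a b s m : sane m -> (0 < a < b)%N -> (b <= N.+1)%N ->
  thist a b s m -> runs find_median m (60 * N + 100) (median_cursor a b).
Proof.
move=> sm /andP[a0 ab] bN h; have sN := hist_size h.
case: s h sN => [|x0 s0] h sN.
  by have := hist_node h (i := a); rewrite leqnn ab => /(_ isT).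
have hc := h; rewrite -[_ :: _]cat0s in hc.
have /andP[x00 x0N] := hist_mem_range hc.
have n0 := hist_nextE (s1 := [::]) h.
have n1 := hist_nextE (s1 := [:: x0]) h; rewrite /= in n0 n1.
do 3 apply: runs_assoc.
apply: (@runs_seq _ _ _ _ 20 (60 * N + 80) _ (fun m' =>
  [/\ ireg m' vM = x0, rreg m' vWl = 0%E, rreg m' vWr = 0%E &
     ireg m' vX = head 0%N s0])); last by lia.
  by apply: runs_wp => //=; rewrite n0 !(sane_isize sm) !ltnS x0N.
move=> m1 fr1 [M1 L1 R1 X1].
have sm1 := sane_frame fr1 isT sm.
have h1 := thist_frame fr1 isT h.
apply: (@runs_seq _ _ _ _ (20 * N + 20) (40 * N + 50) _ (fun m' =>
  rreg m' vWr = (mass m' a b s0)%:E)); last by lia.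
  apply: (runs_while (B := 10) (k := size s0) (I := fun k m' => exists t1 t2,
    [/\ k = size t2, s0 = t1 ++ t2, ireg m' vX = head 0%N t2 &
      rreg m' vWr = (mass m' a b t1)%:E])); last by move: sN => /=; lia.
    by exists [::], s0; rewrite /mass nmass_nil.
  move=> k m2 fr2 [t1 [t2 [ks es X2 R2]]].
  have sm2 := sane_frame fr2 isT sm1.
  have h2 := thist_frame fr2 isT h1.
  case: t2 ks es X2 => [|x t2] ks es X2 /=; rewrite X2 /=.
    by split=> //; rewrite es cats0.
  rewrite es -cat_cons in h2.
  have /andP[xx xN] := hist_mem_range h2.
  rewrite -lt0n xx; split=> //; apply: runs_wp => //=.
  rewrite X2 (sane_isize sm2) (sane_rsize sm2) !ltnS xN; do 2!split=> //.
  exists (size t2); first by rewrite ks.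
  exists (rcons t1 x), t2; split=> //=; first by rewrite cat_rcons.
    by rewrite -cat_rcons rcons_cons in h2;
      rewrite -(hist_nextE h2) /= last_rcons.
  rewrite R2 (hist_mem_wgt h2) -EFinD /mass /=; congr (_%:E).
  move: (hist_uniqs h2); rewrite cat_cons /= -cat_rcons cat_uniq => /and3P[_ u
    _].
  by rewrite -cats1 nmass_cat ?cats1.
move=> m2 fr2 R2.
have sm2 := sane_frame fr2 isT sm1.
have h2 := thist_frame fr2 isT h1.
have M2 : ireg m2 vM = x0 by rewrite (frame_ireg fr2).
have L2 : rreg m2 vWl = 0%E by rewrite (frame_rreg fr2).
apply: (runs_while (B := 20) (k := size s0) (I := fun k m' => exists s1 x s2,
  [/\ k = size s2, cursor a b s1 x s2 m' &
   mass m' a b s1 <= mass m' a b s2 + mass m' a b [:: x]]));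
     last by move: sN => /=; lia.
  exists [::], x0, s0; split=> //; first by split=> //;
    rewrite L2 /mass nmass_nil.
  by rewrite {1}/mass nmass_nil addr_ge0 // (mass_ge0 _ _ sm).
move=> k m3 fr3 [s1 [x [s2 [ks [h3 M3 L3 R3] le3]]]].
have sm3 := sane_frame fr3 isT sm2.
have /andP[xx xN] := hist_mem_range h3.
rewrite /= M3 (sane_rsize sm3) ltnS xN L3 R3 (hist_mem_wgt h3) -EFinD lte_fin.
split=> //; case: ltP => [lt|ge]; last first.
  by exists s1, x, s2; split.
case: s2 h3 ks R3 le3 lt => [|y s2] h3 ks R3 le3 lt.
  move: lt; rewrite {2}/mass nmass_nil ltNge addr_ge0 //;
    exact: (mass_ge0 _ _ sm).
have h3' := h3; rewrite -cat_rcons in h3'.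
have /andP[yy yN] := hist_mem_range h3'.
have nxy := hist_nextE h3'; rewrite last_rcons /= in nxy.
apply: runs_wp => //=; rewrite M3 nxy !(sane_isize sm3) !(sane_rsize sm3) !ltnS
  xN yN.
do 3!split=> //; exists (size s2); first by rewrite ks.
exists (rcons s1 x), y, s2; split=> //; first split=> //=.
- by rewrite L3 (hist_mem_wgt h3) -EFinD /mass /= (hist_nmass_rcons h3).
- rewrite R3 (hist_mem_wgt h3') -EFinB /mass /= (hist_nmass_cons h3').
  by rewrite addrAC subrr add0r.
- have := ltW lt; rewrite /mass /= (hist_nmass_rcons h3) (hist_nmass_cons h3')
  ![_ + nmass _ _ _ _ [:: y]]addrC.
  exact.
Qed.

Lemma sum_deviations_spec a b s (y : R) m : sane m -> (ireg m vM <= N)%N ->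
  nth 0%E (rheap m aVal) (ireg m vM) = y%:E -> thist a b s m ->
  runs sum_deviations m (60 * N + 100)
    (fun m' => rreg m' vD = (dev F W a b y)%:E).
Proof.
move=> sm MN Vy h; have sN := hist_size h.
have n0 := hist_nextE (s1 := [::]) h; rewrite /= in n0.
apply: runs_assoc.
apply: (@runs_seq _ _ _ _ 20 (60 * N + 80) _ (fun m' =>
  [/\ rreg m' vD = 0%E & ireg m' vX = head 0%N s])); last by lia.
  by apply: runs_wp => //=; rewrite n0 !(sane_isize sm).
move=> m1 fr1 [D1 X1].
have sm1 := sane_frame fr1 isT sm.
have h1 := thist_frame fr1 isT h.
(* Partial sums are masses for the weights [V]: all data at a node share its value, so one product
   per node accounts for all of them. *)
pose V i := W i * `|F i - y|.
apply: (runs_while (B := 20) (k := size s) (I := fun k m' => exists t1 t2,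
  [/\ k = size t2, s = t1 ++ t2, ireg m' vX = head 0%N t2 &
    rreg m' vD = (nmass V a b (nth 0%N (iheap m aNode)) t1)%:E]));
  last by move: sN => /=; lia.
  by exists [::], s; rewrite nmass_nil.
move=> k m2 fr2 [t1 [t2 [ks es X2 D2]]].
have sm2 := sane_frame fr2 isT sm1.
have h2 := thist_frame fr2 isT h1.
have eM : ireg m2 vM = ireg m vM by rewrite (frame_ireg fr2) // (frame_ireg
  fr1).
have eV : rheap m2 aVal = rheap m aVal by rewrite (frame_rheap fr2) //
  (frame_rheap fr1).
have eI : iheap m2 aNode = iheap m aNode by rewrite (frame_iheap fr2) //
  (frame_iheap fr1).
case: t2 ks es X2 => [|x t2] ks es X2 /=; rewrite X2 /=.
  split=> //; rewrite D2; congr (_%:E); apply: eq_big_nat => i ib.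
  by have := hist_node h ib; rewrite es cats0 => ->; rewrite mulr1n.
rewrite es in h2.
have xs : x \in t1 ++ x :: t2 by rewrite mem_cat mem_head orbT.
have /andP[xx xN] := hist_mem_range h2.
rewrite -lt0n xx; split=> //; apply: runs_wp => //=.
rewrite X2 eM (sane_isize sm2) !(sane_rsize sm2) !ltnS xN MN; do 2!split=> //.
exists (size t2); first by rewrite ks.
exists (rcons t1 x), t2; split=> //=; first by rewrite cat_rcons.
  by rewrite -cat_rcons in h2; rewrite -(hist_nextE h2) /= last_rcons.
have [i0 i0b [ix Vx]] := hist_fin h2 xs.
have u : uniq (t1 ++ [:: x]).
  by move: (hist_uniqs h2); rewrite -cat_rcons cats1 cat_uniq => /and3P[].
rewrite D2 (hist_mem_wgt h2) Vx eV Vy -EFinB /= -EFinM -EFinD -cats1 nmass_cat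
  //.
congr ((_ + _)%:E); rewrite /nmass mulr_suml eI; apply: eq_big_nat => i ib.
rewrite mem_seq1; case: eqP => [ndx|_]; rewrite ?mulr0n ?mul0r // !mulr1n /V.
by have := hist_val h2 ib; rewrite eI ndx Vx => -[->].
Qed.

(** * Removals and shifts of the median *)

(* After a removal the node x of M may have been unlinked (lk = false); its   *)
(* own pointers then still lead to its former neighbours.                     *)
Record cut a b s1 (lk : bool) x s2 (y : R) m : Prop := Cut {
  cut_hist : thist a b (s1 ++ nseq lk x ++ s2) m;
  cut_M : ireg m vM = x;
  cut_range : (0 < x <= N)%N;
  cut_val : nth 0%E (rheap m aVal) x = y%:E;
  cut_wgt : nth 0%E (rheap m aTWgt) x = (mass m a b [:: x])%:E;
  cut_lk : lk = (mass m a b [:: x] != 0);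
  cut_next : nth 0%N (iheap m aTNext) x = head 0%N s2;
  cut_prev : nth 0%N (iheap m aTPrev) x = last 0%N s1;
  cut_lt : {in s1, forall z, (nth 0%E (rheap m aVal) z < y%:E)%E};
  cut_gt : {in s2, forall z, (y%:E < nth 0%E (rheap m aVal) z)%E};
  cut_Wl : rreg m vWl = (mass m a b s1)%:E;
  cut_Wr : rreg m vWr = (mass m a b s2)%:E;
  cut_D : rreg m vD = (dev F W a b y)%:E }.

Lemma cut_linked a b s1 x s2 (y : R) m : sane m -> (0 < a)%N -> (b <= N.+1)%N ->
  thist a b (s1 ++ x :: s2) m -> ireg m vM = x ->
  nth 0%E (rheap m aVal) x = y%:E ->
  rreg m vWl = (mass m a b s1)%:E -> rreg m vWr = (mass m a b s2)%:E ->
  rreg m vD = (dev F W a b y)%:E -> cut a b s1 true x s2 y m.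
Proof.
move=> sm a0 bN h Mx vx Wl Wr D.
have xs : x \in s1 ++ x :: s2 by rewrite mem_cat mem_head orbT.
have [lt gt] := hist_lt1 h; have h' := h; rewrite -cat_rcons in h'.
split=> //.
- exact: hist_mem_range h.
- exact: hist_mem_wgt h.
- rewrite gt_eqF //; apply: hist_mass_gt0 (sane_gt0 sm a0 bN) h xs _.
  exact: mem_head.
- by rewrite -(hist_nextE h') last_rcons.
- exact: hist_prevE h.
- by rewrite -vx.
- by rewrite -vx.
Qed.

(** An unlinked [x] has mass 0, so one formula serves both cases. *)
Lemma nmass_lk a b nd s1 (lk : bool) x s2 :
  uniq (s1 ++ nseq lk x ++ s2) -> lk = (nmass W a b nd [:: x] != 0) ->
  nmass W a b nd (s1 ++ nseq lk x) = nmass W a b nd s1 + nmass W a b nd [:: x]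
    /\
  nmass W a b nd (nseq lk x ++ s2) = nmass W a b nd [:: x] + nmass W a b nd s2.
Proof.
move=> u; case: lk u => /= u; last first.
  by move=> e; have /eqP-> := negbFE (esym e); rewrite cats0 addr0 add0r.
move=> _; move: (u); rewrite -cat1s catA cat_uniq => /and3P[u1 _ _]; split.
  by rewrite nmass_cat.
by rewrite nmass_cat //; move: u; rewrite cat_uniq => /and3P[].
Qed.

(** This also holds when M is unlinked: its temporary weight is 0, its value is still the point at
    which d is taken, and its next pointer still leads to [z]. *)
Lemma shift_right_spec a b s1 (lk : bool) x z s2 (y : R) m :
  sane m -> (0 < a)%N -> (b <= N.+1)%N -> cut a b s1 lk x (z :: s2) y m ->
  runs shift_right m 60 (fun m' => exists y' : R,
    cut a b (s1 ++ nseq lk x) true z s2 y' m').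
Proof.
move=> sm a0 bN c; have h := cut_hist c.
have u := hist_uniqs h.
have [ml mr] := nmass_lk u (cut_lk c).
have /andP[xx xN] := cut_range c.
rewrite catA in h u.
have /andP[zz zN] := hist_mem_range h.
have zs : z \in (s1 ++ nseq lk x) ++ z :: s2 by rewrite mem_cat mem_head orbT.
have [i ib [iz vz]] := hist_fin h zs.
have yz : y <= F i by have := cut_gt c (mem_head z s2);
  rewrite vz lte_fin => /ltW.
apply: runs_wp => //=; rewrite (cut_M c) (cut_next c) /= !(sane_isize sm)
  !(sane_rsize sm).
rewrite !ltnS xN zN; do 4!split=> //; exists (F i).
apply: cut_linked => //=.
- by split; case: sm.
- by rewrite (cut_Wl c) (cut_wgt c) -EFinD /mass /= ml.
- by rewrite (cut_Wr c) (hist_mem_wgt h) -EFinB /mass /= (hist_nmass_cons h)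
  addrAC subrr add0r.
- rewrite (cut_D c) (cut_val c) vz (cut_Wl c) (cut_wgt c) (cut_Wr c).
  rewrite -!(EFinB, EFinD, EFinM) /mass -ml; congr (_%:E); apply/esym.
  apply: dev_shift => // j jb.
  + exact: (hist_node h).
  + move=> js; rewrite -lee_fin -(hist_val h jb); move: js; rewrite mem_cat.
    case/orP=> [/(cut_lt c)/ltW//|]; rewrite mem_nseq => /andP[_ /eqP->].
    by rewrite (cut_val c).
  + rewrite in_cons => /orP[/eqP jz|js].
      by have := hist_val h jb; rewrite jz vz => -[->].
    by rewrite -lee_fin -(hist_val h jb) -vz ltW // (hist_lt1 h).2.
Qed.

Lemma shift_left_spec a b s1 (lk : bool) x z s2 (y : R) m :
  sane m -> (0 < a)%N -> (b <= N.+1)%N -> cut a b (rcons s1 z) lk x s2 y m ->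
  runs shift_left m 60 (fun m' => exists y' : R,
    cut a b s1 true z (nseq lk x ++ s2) y' m').
Proof.
move=> sm a0 bN c; have h := cut_hist c.
have u := hist_uniqs h.
have [ml mr] := nmass_lk u (cut_lk c).
have /andP[xx xN] := cut_range c.
rewrite cat_rcons in h.
have /andP[zz zN] := hist_mem_range h.
have zs : z \in s1 ++ z :: nseq lk x ++ s2 by rewrite mem_cat mem_head orbT.
have [i ib [iz vz]] := hist_fin h zs.
have zy : F i <= y.
  have : (nth 0%E (rheap m aVal) z < y%:E)%E.
    by apply: (cut_lt c); rewrite mem_rcons mem_head.
  by rewrite vz lte_fin => /ltW.
apply: runs_wp => //=; rewrite (cut_M c) (cut_prev c) last_rcons !(sane_isize
  sm) !(sane_rsize sm).
rewrite !ltnS xN zN; do 4!split=> //; exists (F i).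
apply: cut_linked => //=.
- by split; case: sm.
- by rewrite (cut_Wl c) (hist_mem_wgt h) -EFinB /mass /= (hist_nmass_rcons h)
  addrK.
- by rewrite (cut_Wr c) (cut_wgt c) -EFinD /mass /= mr addrC.
- rewrite (cut_D c) (cut_val c) vz (cut_Wl c) (cut_wgt c) (cut_Wr c).
  rewrite -!(EFinB, EFinD, EFinM) /mass [nmass _ _ _ _ s2 + _]addrC -mr;
    congr (_%:E).
  rewrite (@dev_shift _ F W a b (nth 0%N (iheap m aNode)) (rcons s1 z) (nseq lk
    x ++ s2) (F i) y) //.
  + ring.
  + by move=> j jb; rewrite cat_rcons; apply: (hist_node h).
  + move=> j jb; rewrite mem_rcons in_cons => /orP[/eqP jz|js].
      by have := hist_val h jb; rewrite jz vz => -[->].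
    by rewrite -lee_fin -(hist_val h jb) -vz ltW // (hist_lt1 h).1.
  + move=> j jb; rewrite mem_cat => js; rewrite -lee_fin -(hist_val h jb);
    move: js.
    case/orP=> [|/(cut_gt c)/ltW//]; rewrite mem_nseq => /andP[_ /eqP->].
    by rewrite (cut_val c).
Qed.

(** Each balance inequality can lose at most the removed weight, and only on its right-hand side. M
    keeps its place, so d loses just the summand of the datum [a]. *)
Lemma remove_temporary_spec a b s1 x s2 (y : R) m :
  sane m -> (0 < a < b)%N -> (b <= N.+1)%N -> ireg m vL = a ->
  cut a b s1 true x s2 y m ->
  mass m a b s1 <= mass m a b s2 + mass m a b [:: x] ->
  mass m a b s2 <= mass m a b s1 + mass m a b [:: x] ->
  runs remove_temporary m 150 (fun m' => exists s1' (lk : bool) s2',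
    [/\ cut a.+1 b s1' lk x s2' y m',
        mass m' a.+1 b s1' <= mass m' a.+1 b s2' + mass m' a.+1 b [:: x] + W a &
        mass m' a.+1 b s2' <= mass m' a.+1 b s1' + mass m' a.+1 b [:: x] + W
          a]).
Proof.
move=> sm /andP[a0 ab] bN La c med1 med2.
have h := cut_hist c; rewrite /= in h.
have aN : (a <= N)%N by rewrite -ltnS (leq_trans ab).
pose X := nth 0%N (iheap m aNode) a.
have Xs : X \in s1 ++ x :: s2 by apply: (hist_node h); rewrite leqnn ab.
have /andP[X0 XN] := hist_range h Xs.
have /andP[x0 xN] := cut_range c.
have Wpos := sane_gt0 sm a0 bN.
have Wpos' i : (a.+1 <= i < b)%N -> 0 < W i.
  by move=> /andP[ai ib]; apply: Wpos; rewrite (ltnW ai).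
have valX : nth 0%E (rheap m aVal) X = (F a)%:E by apply: (hist_val h);
  rewrite leqnn ab.
have recl t : nmass W a b (nth 0%N (iheap m aNode)) t =
    W a *+ (X \in t) + nmass W a.+1 b (nth 0%N (iheap m aNode)) t.
  exact: nmass_recl.
(* Comparing values tells on which side of M the node [X] lies, as the list is strictly sorted. *)
have vlt : (nth 0%E (rheap m aVal) X < y%:E)%E = (X \in s1).
  apply/idP/idP => [lt|/(cut_lt c)//]; move: Xs.
  rewrite mem_cat in_cons => /or3P[//|/eqP Xx|/(cut_gt c)/(lt_trans lt)];
    last by rewrite ltxx.
  by rewrite Xx (cut_val c) ltxx in lt.
have vgt : (y%:E < nth 0%E (rheap m aVal) X)%E = (X \in s2).
  apply/idP/idP => [lt|/(cut_gt c)//]; move: Xs.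
  rewrite mem_cat in_cons => /or3P[/(cut_lt c)/(lt_trans lt)|/eqP Xx|//];
    first by rewrite ltxx.
  by rewrite Xx (cut_val c) ltxx in lt.
do 3 apply: runs_assoc.
apply: (@runs_seq _ _ _ _ 80 60 _ (fun m' =>
  [/\ ireg m' vX = X, rreg m' vD = (dev F W a.+1 b y)%:E,
      rreg m' vWl = (mass m' a.+1 b s1)%:E, rreg m' vWr = (mass m' a.+1 b
        s2)%:E &
      forall z, nth 0%E (rheap m' aTWgt) z =
        if z == X then (nth 0%E (rheap m aTWgt) X - (W a)%:E)%E
        else nth 0%E (rheap m aTWgt) z])); last by [].
  apply: runs_wp => //=.
  rewrite La (cut_M c) !(sane_isize sm) !(sane_rsize sm) -/X !ltnS aN xN XN.
  rewrite (cut_val c) vlt vgt (sane_F sm) ?a0 // (sane_W sm) ?a0 //.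
  rewrite (cut_D c) (cut_Wl c) (cut_Wr c) -EFinB.
  rewrite dev_recl // addrAC subrr add0r /mass !recl.
  have nth_tw z : nth 0%E (set_nth 0%E (rheap m aTWgt) X
     (nth 0%E (rheap m aTWgt) X - (W a)%:E)%E) z =
     if z == X then (nth 0%E (rheap m aTWgt) X - (W a)%:E)%E
        else nth 0%E (rheap m aTWgt) z by rewrite nth_set_nth.
  have u := hist_uniqs h; have := u; rewrite cat_uniq => /and3P[_ /hasPn u12 _].
  do 3!split=> //; case: ifP => X1.
    have /negPf X2 : X \notin s2.
      by apply: contraTN X1 => X2; apply: u12; rewrite in_cons X2 orbT.
    do 3!split=> //; last by rewrite X2 mulr0n add0r.
    by rewrite X1 mulr1n -EFinB addrAC subrr add0r.
  split=> //; case: ifP => X2; do !split=> //;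
    rewrite ?X1 ?X2 ?mulr0n ?add0r //.
  by rewrite mulr1n -EFinB addrAC subrr add0r.
move=> m1 fr1 [X1 D1 L1 R1 T1].
have sm1 := sane_frame fr1 isT sm.
have eV : rheap m1 aVal = rheap m aVal by rewrite (frame_rheap fr1).
have eI : iheap m1 aNode = iheap m aNode by rewrite (frame_iheap fr1).
have eN : iheap m1 aTNext = iheap m aTNext by rewrite (frame_iheap fr1).
have eP : iheap m1 aTPrev = iheap m aTPrev by rewrite (frame_iheap fr1).
have M1 : ireg m1 vM = x by rewrite (frame_ireg fr1) // (cut_M c).
pose mu := nmass W a.+1 b (nth 0%N (iheap m aNode)).
have mum m' t : iheap m' aNode = iheap m aNode -> mass m' a.+1 b t = mu t.
  by move=> e; rewrite /mass e.
have u := hist_uniqs h.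
have tX : nth 0%E (rheap m1 aTWgt) X = (mu [:: X])%:E.
  by rewrite T1 eqxx (hist_wgt h) // recl mem_head mulr1n -EFinB addrAC subrr
    add0r.
have wa : 0 < W a by apply: Wpos; rewrite leqnn ab.
have exc t1 t2 : x \notin t2 ->
    mass m a b t1 <= mass m a b t2 + mass m a b [:: x] ->
    mu t1 <= mu t2 + mu [:: x] + W a.
  rewrite /mass !recl -/mu mem_seq1 => xt2 le.
  have : W a *+ (X \in t2) + W a *+ (X == x) <= W a.
    rewrite -mulrnDr; case: eqP => [->|_]; first by rewrite (negPf xt2) mulr1n.
    by case: (X \in t2); rewrite ?mulr1n ?mulr0n // ltW.
  have : 0 <= W a *+ (X \in t1) by rewrite mulrn_wge0 // ltW.
  lra.
have /andP[xs2 xs1] : (x \notin s2) && (x \notin s1).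
  move: (u); rewrite uniq_catC cat_cons cons_uniq mem_cat negb_or.
  by case/andP.
have E1 : mu s1 <= mu s2 + mu [:: x] + W a by apply: exc.
have E2 : mu s2 <= mu s1 + mu [:: x] + W a by apply: exc.
have hx : nth 0%E (rheap m1 aVal) x = y%:E by rewrite eV (cut_val c).
have [mX|mX] := eqVneq (mu [:: X]) 0; last first.
  apply: runs_wp => //=; rewrite X1 (sane_rsize sm1) ltnS XN tX eqe (negPf mX).
  split=> //; exists s1, true, s2; rewrite !mum //; split=> //.
  apply: (cut_linked sm1) => //.
  by rewrite /thist eN eP eI eV; apply: hist_remove_keep h erefl mX T1.
have nX := nmass1_eq0 Wpos' mX.
(* The list is split in two ways: at the emptied node [X] into [p] and [q], and, after [X] is
   dropped, at M into [s1'] and [s2']. If [X] is M itself, the splittings coincide and M becomes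
   unlinked. Masses do not change, since no remaining datum has node [X]. *)
have [p [q [s1' [s2' [es es' [ms1 ms2] [sub1 sub2] lkE]]]]] : exists p q s1'
  s2',
    [/\ s1 ++ x :: s2 = p ++ X :: q, p ++ q = s1' ++ nseq (X != x) x ++ s2',
        mu s1' = mu s1 /\ mu s2' = mu s2,
        {subset s1' <= s1} /\ {subset s2' <= s2} & X = x -> s1' = p /\ s2' = q].
  have drop p q : mu (p ++ q) = mu (p ++ X :: q) by rewrite /mu nmass0_notin.
  have subd p q : {subset p ++ q <= p ++ X :: q}.
    by move=> z; rewrite !mem_cat in_cons => /orP[]->; rewrite ?orbT.
  move: (Xs); rewrite mem_cat in_cons; have [Xx _|Xx] := eqVneq X x.
    by exists s1, s2, s1, s2; rewrite Xx; do !split.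
  case/orP=> /path.splitPr[p q].
    exists p, (q ++ x :: s2), (p ++ q), s2; rewrite -!catA; do !split=> //;
      try (exact: subd || exact: drop);
      by case/eqP: Xx.
  exists (s1 ++ x :: p), q, s1, (p ++ q); rewrite -!catA; do !split=> //;
    try (exact: subd || exact: drop);
      by case/eqP: Xx.
rewrite es in h.
have pvX : nth 0%N (iheap m aTPrev) X = last 0%N p := hist_prevE h.
have nxX : nth 0%N (iheap m aTNext) X = head 0%N q.
  by have h' := h; rewrite -cat_rcons in h';
    rewrite -(hist_nextE h') last_rcons.
have h' := h; rewrite -cat_rcons in h'.
have [lpN _] := hist_ends h; have [_ hqN] := hist_ends h'.
have := hist_uniq h; rewrite -cat_cons cat_uniq => /and3P[_ /hasPn up uq].
have Xl : (X == last 0%N p) = false.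
  by apply/negP => /eqP Xl; have := up X (mem_head _ _); rewrite Xl mem_last.
have Xh : (X == head 0%N q) = false.
  apply/negP => /eqP Xh; move: X0 uq; rewrite Xh; case: (q) => //= z t _.
  by rewrite mem_head.
apply: runs_wp => //=; rewrite X1 (sane_rsize sm1) ltnS XN tX mX eqxx.
rewrite eN eP pvX nth_set_nth /= Xl nxX !size_set_nth !(sane_isize sm) !ltnS.
rewrite leq_max !ltnS XN lpN hqN orbT; split=> //; split=> //; split=> //.
exists s1', (X != x), s2'; rewrite !mum // ms1 ms2; split=> //.
set m2 := set_iheap _ _ _.
have h2 : thist a.+1 b (p ++ q) m2.
  rewrite /thist /= eI eV; apply: (hist_remove_drop ab Wpos' h erefl mX) => /=.
  - by rewrite nth_set_nth /= eqxx.
  - by move=> z zl; rewrite nth_set_nth /= (negPf zl).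
  - by rewrite nth_set_nth /= eqxx.
  - by move=> z zl; rewrite nth_set_nth /= (negPf zl).
  - by move=> z zX; rewrite T1 (negPf zX).
rewrite es' in h2.
have [Xx|Xx] := eqVneq X x; last first.
  rewrite Xx in h2.
  have sm2 : sane m2.
    case: (sm1) => q1 q2 q3 q4 q5 q6 q7; split=> //= z.
    by case: eqP => _; [|case: eqP => _ //];
      rewrite size_set_nth (sane_isize sm); apply/maxn_idPr.
  by apply: (cut_linked sm2); rewrite ?mum ?ms1 ?ms2 -?(mum m1).
have [e1 e2] := lkE Xx.
split=> //=; rewrite ?mum // ?ms1 ?ms2 -?(mum m1) //.
- by rewrite Xx eqxx in h2.
- by rewrite x0.
- by rewrite mum // -Xx tX.
- by rewrite mum // -Xx mX eqxx.
- by rewrite nth_set_nth /= -Xx Xl nxX e2.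
- by rewrite nth_set_nth /= -Xx Xh pvX e1.
- by move=> z /sub1; rewrite eV; apply: (cut_lt c).
- by move=> z /sub2; rewrite eV; apply: (cut_gt c).
Qed.

(** A linked M that is a median up to an excess [e1] of the left side and [e2] of the right side;
    for 0 and 0 it is a median. *)
Definition balanced a b (e1 e2 : R) m : Prop := exists s1 x s2 (y : R),
  [/\ cut a b s1 true x s2 y m,
      mass m a b s1 <= mass m a b s2 + mass m a b [:: x] + e1 &
      mass m a b s2 <= mass m a b s1 + mass m a b [:: x] + e2].

(** The node [z] leaves the right side and weighs at least [wmin], which pays for that part of the
    excess. By the guard the left side does not overshoot, so any nonnegative [e1] will do. *)
Lemma balanced_right a b s1 (lk : bool) x z s2 (y e1 e2 : R) wmin m :
  sane m -> (0 < a)%N -> (b <= N.+1)%N ->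
  0 < wmin -> (forall i, (0 < i <= N)%N -> wmin <= W i) ->
  cut a b s1 lk x (z :: s2) y m ->
  mass m a b s1 + mass m a b [:: x] <= mass m a b (z :: s2) -> 0 <= e1 -> 0 <=
    e2 ->
  mass m a b (z :: s2) <= mass m a b s1 + mass m a b [:: x] + wmin + e2 ->
  runs shift_right m 60 (balanced a b e1 e2).
Proof.
move=> sm a0 bN w0 wle c le1 e10 e20 le2.
apply: runs_weaken (shift_right_spec sm a0 bN c) _ (leqnn _) => m' fr [y' c'].
exists (s1 ++ nseq lk x), z, s2, y'; split=> //;
  rewrite !(mass_frame _ _ _ fr) //.
all: have h := cut_hist c; have [ml _] := nmass_lk (hist_uniqs h) (cut_lk c).
all: rewrite catA in h; have mz := hist_nmass_cons h.
all: have zs : z \in (s1 ++ nseq lk x) ++ z :: s2 by rewrite mem_cat mem_head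
  orbT.
all: have [i ib iz] := hist_onto h zs.
all: have wz : wmin <= mass m a b [:: z].
1,3: apply: le_trans (_ : W i <= _); last by apply: nmass_ge;
  rewrite ?iz ?mem_head // => j /(sane_gt0 sm a0 bN)/ltW.
1,2: by apply: wle; case/andP: ib => ai ib;
  rewrite (leq_trans a0 ai) -ltnS (leq_trans ib).
all: move: le1 le2 wz w0; rewrite /mass ml mz; lra.
Qed.

Lemma balanced_left a b s1 (lk : bool) x z s2 (y e1 e2 : R) wmin m :
  sane m -> (0 < a)%N -> (b <= N.+1)%N ->
  0 < wmin -> (forall i, (0 < i <= N)%N -> wmin <= W i) ->
  cut a b (rcons s1 z) lk x s2 y m ->
  mass m a b s2 + mass m a b [:: x] <= mass m a b (rcons s1 z) -> 0 <= e1 -> 0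
    <= e2 ->
  mass m a b (rcons s1 z) <= mass m a b s2 + mass m a b [:: x] + wmin + e1 ->
  runs shift_left m 60 (balanced a b e1 e2).
Proof.
move=> sm a0 bN w0 wle c le1 e10 e20 le2.
apply: runs_weaken (shift_left_spec sm a0 bN c) _ (leqnn _) => m' fr [y' c'].
exists s1, z, (nseq lk x ++ s2), y'; split=> //;
  rewrite !(mass_frame _ _ _ fr) //.
all: have h := cut_hist c; have [_ mr] := nmass_lk (hist_uniqs h) (cut_lk c).
all: rewrite cat_rcons in h; have mz := hist_nmass_rcons h.
all: have zs : z \in s1 ++ z :: nseq lk x ++ s2 by rewrite mem_cat mem_head
  orbT.
all: have [i ib iz] := hist_onto h zs.
all: have wz : wmin <= mass m a b [:: z].
1,3: apply: le_trans (_ : W i <= _); last by apply: nmass_ge;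
  rewrite ?iz ?mem_head // => j /(sane_gt0 sm a0 bN)/ltW.
1,2: by apply: wle; case/andP: ib => ai ib;
  rewrite (leq_trans a0 ai) -ltnS (leq_trans ib).
all: move: le1 le2 wz w0; rewrite /mass mr mz; lra.
Qed.

(* Each shift moves a node of weight at least wmin across the pointer, and a  *)
(* removal unbalances the two sides by at most K * wmin.                      *)
Lemma shift_median_spec a b s1 (lk : bool) x s2 (y : R) wmin (K : nat) m :
  sane m -> (0 < a < b)%N -> (b <= N.+1)%N -> 0 < wmin ->
  (forall i, (0 < i <= N)%N -> wmin <= W i) ->
  cut a b s1 lk x s2 y m ->
  mass m a b s1 <= mass m a b s2 + mass m a b [:: x] + K%:R * wmin ->
  mass m a b s2 <= mass m a b s1 + mass m a b [:: x] + K%:R * wmin ->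
  runs shift_median m (200 * K + 200) (balanced a b 0 0).
Proof.
move=> sm /andP[a0 ab] bN w0 wle c le1 le2.
have Kw (k : nat) : 0 <= k%:R * wmin by rewrite mulr_ge0 // ltW.
have Wpos := sane_gt0 sm a0 bN.
apply: (@runs_seq _ _ _ _ 100 (200 * K + 100) _
  (balanced a b (K%:R * wmin) (K%:R * wmin))); last by lia.
  have /andP[x0 xN] := cut_range c; have h := cut_hist c.
  apply: (@runs_if _ _ _ _ _ 80); rewrite /= ?(cut_M c) ?(sane_rsize sm) ?ltnS
    ?xN //;
    rewrite (cut_wgt c) eqe.
    move=> /eqP mx; have lkF := cut_lk c; rewrite mx eqxx /= in lkF; subst lk.
    (* As [a < b], some datum is left; so the heavier side, towards which M moves, is not empty. *)
    have hnd : nth 0%N (iheap m aNode) a \in s1 ++ s2 by apply: (hist_node h);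
      rewrite leqnn ab.
    apply: (@runs_if _ _ _ _ _ 60); rewrite /= ?(cut_Wl c) ?(cut_Wr c) ?lee_fin
      //.
      case: s2 c le1 le2 h hnd => [|z s2] c le1 le2 h hnd le.
        rewrite cats0 in hnd; have := hist_mass_gt0 Wpos h (x := nth 0%N (iheap
          m aNode) a) (t := s1).
        rewrite mem_cat hnd => /(_ isT isT); move: le.
        by rewrite mass_nil => /le_lt_trans H /H; rewrite ltxx.
      apply: (balanced_right sm a0 bN w0 wle c) => //.
        by rewrite mx addr0.
      by move: le2; rewrite mx; lra.
    rewrite -ltNge => lt; case/lastP: s1 c le1 le2 h hnd lt => [|s1 z] c le1
      le2 h hnd lt.
      have : 0 <= mass m a b s2 by apply: (mass_ge0 _ _ sm).
      by move/le_lt_trans/(_ lt); rewrite mass_nil ltxx.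
    apply: (balanced_left sm a0 bN w0 wle c) => //.
      by rewrite mx addr0 ltW.
    by move: le1; rewrite mx; lra.
  move=> mx; have lkT := cut_lk c; rewrite mx /= in lkT; subst lk.
  by apply: runs_wp => //=; exists s1, x, s2, y; split.
move=> m1 fr1 bal1; have sm1 := sane_frame fr1 isT sm.
apply: (@runs_seq _ _ _ _ (100 * K + 50) (100 * K + 50) _
  (balanced a b (K%:R * wmin) 0)); last by lia.
  (* The loop counter is the excess of the right side in units of [wmin]; at 0 the guard must fail.
     The excess of the left side is kept at its old bound for the second loop. *)
  apply: (runs_while (B := 60) (k := K) (I := fun k => balanced a b (K%:R *
    wmin) (k%:R * wmin)));
    [exact: bal1| |by move=> /=; lia].
  move=> k m2 fr2 [t1 [z [t2 [y' [c2 bl br]]]]].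
  have sm2 := sane_frame fr2 isT sm1.
  have /andP[z0 zN] := cut_range c2.
  rewrite /= (cut_M c2) (sane_rsize sm2) ltnS zN (cut_Wl c2) (cut_wgt c2)
    (cut_Wr c2).
  rewrite -EFinD lte_fin; split=> //; case: ltP => [lt|ge]; last first.
    by exists t1, z, t2, y'; split=> //; rewrite addr0.
  case: k br => [|k] br; first by move: br lt;
    rewrite mul0r addr0 leNgt => /negPf->.
  case: t2 c2 bl br lt => [|z2 t2] c2 bl br lt.
    by move: lt; rewrite mass_nil ltNge addr_ge0 //; apply: (mass_ge0 _ _ sm).
  have Kb : (60 <= 60)%N by [].
  apply: runs_weaken (balanced_right sm2 a0 bN w0 wle c2 (ltW lt) (Kw K) (Kw k)
    _) _ Kb.
    by move: br; rewrite -[k.+1]addn1 natrD; lra.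
  by move=> m' _ bal; exists k.
move=> m2 fr2 bal2; have sm2 := sane_frame fr2 isT sm1.
(* Shifts to the left do not unbalance the right side again, whose excess stays 0. *)
apply: (runs_while (B := 60) (k := K) (I := fun k => balanced a b (k%:R * wmin)
  0));
    [exact: bal2| |by move=> /=; lia].
move=> k m3 fr3 [t1 [z [t2 [y' [c3 bl br]]]]].
have sm3 := sane_frame fr3 isT sm2.
have /andP[z0 zN] := cut_range c3.
rewrite /= (cut_M c3) (sane_rsize sm3) ltnS zN (cut_Wl c3) (cut_wgt c3) (cut_Wr
  c3).
rewrite -EFinD lte_fin; split=> //; case: ltP => [lt|ge]; last first.
  by exists t1, z, t2, y'; split=> //; rewrite addr0.
case: k bl => [|k] bl; first by move: bl lt;
  rewrite mul0r addr0 leNgt => /negPf->.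
case/lastP: t1 c3 bl br lt => [|t1 z2] c3 bl br lt.
  by move: lt; rewrite mass_nil ltNge addr_ge0 //; apply: (mass_ge0 _ _ sm).
have Kb : (60 <= 60)%N by [].
apply: runs_weaken (balanced_left sm3 a0 bN w0 wle c3 (ltW lt) (Kw k) (lexx 0)
  _) _ Kb.
  by move: bl; rewrite -[k.+1]addn1 natrD; lra.
by move=> m' _ bal; exists k.
Qed.

Lemma cut_frame c a b s1 lk x s2 (y : R) m m' : frame c m m' ->
  [&& ~~ writes_iheap c aTNext, ~~ writes_iheap c aTPrev, ~~ writes_iheap c
    aNode,
      ~~ writes_rheap c aTWgt & ~~ writes_rheap c aVal] ->
  [&& ~~ writes_ireg c vM, ~~ writes_rreg c vWl, ~~ writes_rreg c vWr &
      ~~ writes_rreg c vD] ->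
  cut a b s1 lk x s2 y m -> cut a b s1 lk x s2 y m'.
Proof.
move=> fr cs; have /and5P[c1 c2 c3 c4 c5] := cs; move=> /and4P[d1 d2 d3 d4].
case=> k1 k2 k3 k4 k5 k6 k7 k8 k9 k10 k11 k12 k13.
split; rewrite ?(frame_ireg fr d1) ?(frame_rreg fr) ?(mass_frame _ _ _ fr)
  ?(frame_iheap fr c1)
  ?(frame_iheap fr c2) ?(frame_rheap fr c4) ?(frame_rheap fr c5) //.
exact: thist_frame fr cs k1.
Qed.

Lemma median_min a b s1 x s2 (y : R) m :
  sane m -> (0 < a)%N -> (b <= N.+1)%N -> thist a b (s1 ++ x :: s2) m ->
  nth 0%E (rheap m aVal) x = y%:E ->
  mass m a b s1 <= mass m a b s2 + mass m a b [:: x] ->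
  mass m a b s2 <= mass m a b s1 + mass m a b [:: x] ->
  forall z, dev F W a b y <= dev F W a b z.
Proof.
move=> sm a0 bN h vx le1 le2 z; have [lt gt] := hist_lt1 h; rewrite vx in lt gt.
apply: (@dev_median _ F W a b (nth 0%N (iheap m aNode)) s1 x s2) => //.
- by move=> i /(sane_gt0 sm a0 bN)/ltW.
- exact: hist_uniqs h.
- exact: hist_node h.
- by move=> i ib /lt; rewrite (hist_val h ib) lte_fin => /ltW.
- by move=> i ib ix; have := hist_val h ib; rewrite ix vx => -[].
- by move=> i ib /gt; rewrite (hist_val h ib) lte_fin => /ltW.
Qed.

(** * The scan over l and the dynamic program *)

Implicit Types (p : nat -> R) (j l r : nat).

(* q and j are the values of P_r and Z_r after the iterations l' < l.         *)
Definition best_before p r l (q : R) j : Prop :=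
  [/\ (forall l' z, (0 < l' < l)%N -> q <= p l'.-1 + gamma + dev F W l' r.+1 z),
      (j < r)%N & exists y : R, p j + gamma + dev F W j.+1 r.+1 y <= q].

(** Before the first comparison P_r is infinite, and only afterwards is it a real number with a
    meaningful Z_r. *)
Definition scanned p r l m : Prop :=
  if l == 1%N then nth 0%E (rheap m aP) r = +oo%E
  else exists q, nth 0%E (rheap m aP) r = q%:E /\
       best_before p r l q (nth 0%N (iheap m aZ) r).

(** The body of the inner loop is cut before the removal: [scan_head] needs M to be a median,
    [scan_tail] restores this for the next l. *)
Definition scan_head : cmd :=
  Seq (SetR vP (aP.[vL - 1%N] + vGamma + vD)%rexp)
  (If (vP <= aP.[vR]) (
        Seq (PutR aP vR vP)
        (PutI aZ vR (vL - 1%N))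
      ) Skip).

Lemma scan_head_spec p r l m : sane m -> (0 < l <= r)%N -> (r <= N)%N ->
  ireg m vR = r -> ireg m vL = l -> balanced l r.+1 0 0 m ->
  (forall j, (j < r)%N -> nth 0%E (rheap m aP) j = (p j)%:E) ->
  scanned p r l m ->
  runs scan_head m 60 (fun m' =>
    [/\ (forall j, j != r -> nth 0%E (rheap m' aP) j = nth 0%E (rheap m aP) j),
        (forall j, j != r -> nth 0%N (iheap m' aZ) j = nth 0%N (iheap m aZ) j) &
        scanned p r l.+1 m']).
Proof.
move=> sm /andP[l0 lr] rN mr ml [s1 [x [s2 [y [c le1 le2]]]]] mp sc.
rewrite addr0 in le1; rewrite addr0 in le2.
have min := median_min sm l0 (rN : (r.+1 <= N.+1)%N) (cut_hist c) (cut_val c)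
  le1 le2.
have lN := leq_trans lr rN.
have pl : nth 0%E (rheap m aP) (l - 1) = (p l.-1)%:E by rewrite subn1 mp //
  prednK.
have lrE : (l - 1 < r)%N by rewrite subn1 prednK.
have l1 : (l.+1 == 1%N) = false by case: (l) l0.
apply: runs_wp => //=; rewrite mr ml !(sane_rsize sm, sane_isize sm)
  (sane_gamma sm) pl (cut_D c) -!EFinD.
rewrite !ltnS rN (leq_trans (leq_subr _ _) lN); split=> //; split=> //.
have best q : (forall l' z, (0 < l' < l)%N -> q <= p l'.-1 + gamma + dev F W l'
  r.+1 z) ->
    q <= p l.-1 + gamma + dev F W l r.+1 y ->
    forall l' z, (0 < l' < l.+1)%N -> q <= p l'.-1 + gamma + dev F W l' r.+1 z.
  move=> h1 h2 l' z /andP[l'0]; rewrite ltnS leq_eqVlt => /orP[/eqP->|l'l].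
    by apply: le_trans h2 _; rewrite lerD2l.
  by apply: h1; rewrite l'0.
case: ifP => le.
  split=> //; split=> //; split=> /=.
  - by move=> j /negPf jr; rewrite nth_set_nth /= jr.
  - by move=> j /negPf jr; rewrite nth_set_nth /= jr.
  - rewrite /scanned l1 /=; eexists; split;
    first by rewrite nth_set_nth /= eqxx.
    rewrite nth_set_nth /= eqxx; split=> //; last by exists y;
      rewrite subn1 prednK.
    apply: best => // l' z l'l; move: sc le; rewrite /scanned.
    case: eqP => [l1'|_]; first by move: l'l; rewrite l1'; case: (l').
    by case=> q [-> [bq _ _]]; rewrite lee_fin => /le_trans; apply; apply: bq.
split=> //; move: sc le; rewrite /scanned l1.
case: eqP => [_ ->|_ [q [-> [bq jr yq]]]]; first by rewrite leey.
rewrite lee_fin => /negbT; rewrite -ltNge => /ltW le.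
by exists q; split=> //; split=> //; apply: best.
Qed.

Definition scan_tail : cmd :=
  Seq remove_temporary
  (Seq (If (BIeq vL vR) Skip shift_median)
  (SetI vL (vL + 1%N)%iexp)).

Lemma scan_tail_spec r l wmin (K : nat) m : sane m -> (0 < l <= r)%N -> (r <=
  N)%N ->
  0 < wmin -> (forall i, (0 < i <= N)%N -> wmin <= W i <= K%:R * wmin) ->
  ireg m vR = r -> ireg m vL = l -> balanced l r.+1 0 0 m ->
  runs scan_tail m (200 * K + 400) (fun m' =>
    ireg m' vL = l.+1 /\ ((l < r)%N -> balanced l.+1 r.+1 0 0 m')).
Proof.
move=> sm /andP[l0 lr] rN w0 wK mr ml [s1 [x [s2 [y [c le1 le2]]]]].
rewrite addr0 in le1; rewrite addr0 in le2.
have lr1 : (0 < l < r.+1)%N by rewrite l0.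
have rN1 : (r.+1 <= N.+1)%N by [].
apply: runs_seq (remove_temporary_spec sm lr1 rN1 ml c le1 le2) _ (_ : 150 +
  (200 * K + 250) <= _)%N;
  last by lia.
move=> m1 fr1 [t1 [lk [t2 [c1 lt1 lt2]]]].
have sm1 := sane_frame fr1 isT sm.
have r1 : ireg m1 vR = r by rewrite (frame_ireg fr1).
have l1 : ireg m1 vL = l by rewrite (frame_ireg fr1).
have Wl : W l <= K%:R * wmin by have := wK l;
  rewrite l0 (leq_trans lr rN) => /(_ isT)/andP[].
apply: (@runs_seq _ _ _ _ (200 * K + 220) 30 _ (fun m' =>
   (l < r)%N -> balanced l.+1 r.+1 0 0 m')); last by lia.
  apply: (@runs_if _ _ _ _ _ (200 * K + 200)%N) => //=; last by lia.
    by rewrite l1 r1 => /eqP lrE; apply: runs_wp => //=;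
      rewrite ?lrE ?ltnn //; lia.
  rewrite l1 r1 => lrN; have lr' : (l < r)%N by rewrite ltn_neqAle lrN.
  apply: runs_weaken (shift_median_spec (K := K) sm1 _ rN1 w0 _ c1 _ _) _
    (leqnn _) => //.
  - by move=> i /wK/andP[].
  - by apply: le_trans lt1 _; rewrite lerD2l.
  - by apply: le_trans lt2 _; rewrite lerD2l.
move=> m2 fr2 bal.
apply: runs_wp => //=; rewrite (frame_ireg fr2) // l1 addn1; split=> //;
  split=> //.
move=> /bal[u1 [z [u2 [y' [c2 ? ?]]]]]; exists u1, z, u2, y'; split=> //.
by case: c2 => *; split.
Qed.

Definition scan_loop : cmd :=
  While (BIle vL vR) (
      SetR vP (aP.[vL - 1%N] + vGamma + vD)%rexp;;
      If (vP <= aP.[vR]) (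
        PutR aP vR vP;;
        PutI aZ vR (vL - 1%N)
      ) Skip;;
      remove_temporary;;
      If (BIeq vL vR) Skip shift_median;;
      SetI vL (vL + 1%N)%iexp)%cmd.

Lemma scan_loop_spec p r wmin (K : nat) m : sane m -> (0 < r <= N)%N ->
  0 < wmin -> (forall i, (0 < i <= N)%N -> wmin <= W i <= K%:R * wmin) ->
  ireg m vR = r -> ireg m vL = 1%N -> balanced 1 r.+1 0 0 m ->
  (forall j, (j < r)%N -> nth 0%E (rheap m aP) j = (p j)%:E) ->
  nth 0%E (rheap m aP) r = +oo%E ->
  runs scan_loop m ((200 * K + 500) * N + 20) (fun m' =>
    [/\ (forall j, j != r -> nth 0%E (rheap m' aP) j = nth 0%E (rheap m aP) j),
        (forall j, j != r -> nth 0%N (iheap m' aZ) j = nth 0%N (iheap m aZ) j) &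
        scanned p r r.+1 m']).
Proof.
move=> sm /andP[r0 rN] w0 wK mr ml bal mp mi.
apply: (runs_while (k := r) (B := (200 * K + 470)%N) (I := fun k m' => exists l,
  [/\ k = (r.+1 - l)%N, (0 < l <= r.+1)%N, ireg m' vL = l,
     (l <= r)%N -> balanced l r.+1 0 0 m' &
     [/\ (forall j, j != r -> nth 0%E (rheap m' aP) j = nth 0%E (rheap m aP) j),
        (forall j, j != r -> nth 0%N (iheap m' aZ) j = nth 0%N (iheap m aZ) j) &
        scanned p r l m']])).
- by exists 1%N; split=> //; rewrite subn1.
- move=> k m1 fr1 [l [ks /andP[l0 lr] l1 bal1 [P1 Z1 sc1]]].
  have sm1 := sane_frame fr1 isT sm.
  have r1 : ireg m1 vR = r by rewrite (frame_ireg fr1).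
  rewrite /= l1 r1; split=> //; case: leqP => [lr'|rl]; last first.
    by have <- : l = r.+1 by apply/eqP; rewrite eqn_leq lr.
  (* After regrouping, the loop body is [scan_head] followed by [scan_tail], by conversion. *)
  apply: runs_assoc.
  have lr1 : (0 < l <= r)%N by rewrite l0.
  apply: (runs_seq (scan_head_spec (p := p) sm1 lr1 rN r1 l1 (bal1 lr') _ sc1))
    (_ : 60 + (200 * K + 400) <= _)%N; last by lia.
    by move=> j jr; rewrite P1 ?mp // ltn_eqF.
  move=> m2 fr2 [P2 Z2 sc2].
  have sm2 := sane_frame fr2 isT sm1.
  have bal2 : balanced l r.+1 0 0 m2.
    have [u1 [z [u2 [y' [c2 le1 le2]]]]] := bal1 lr'; exists u1, z, u2, y'.
    by rewrite !(mass_frame _ _ _ fr2) //; split=> //;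
      apply: cut_frame fr2 isT isT c2.
  apply: runs_weaken (scan_tail_spec sm2 lr1 rN w0 wK _ _ bal2) _ (leqnn _).
  + by rewrite (frame_ireg fr2).
  + by rewrite (frame_ireg fr2).
  move=> m3 fr3 [l3 bal3]; exists (r.+1 - l.+1)%N; first by rewrite ks; lia.
  exists l.+1; split=> //; rewrite (frame_rheap fr3) // (frame_iheap fr3) //;
    split.
  + by move=> j jr; rewrite P2 ?P1.
  + by move=> j jr; rewrite Z2 ?Z1.
  + by move: sc2; rewrite /scanned (frame_rheap fr3) // (frame_iheap fr3).
- rewrite /=; apply: (@leq_trans (N * (200 * K + 475) + 3))%N; last by lia.
  by rewrite leq_add2r leq_mul //; lia.
Qed.

Lemma full_hist_frame c a b m m' : frame c m m' ->
  [&& ~~ writes_iheap c aNext, ~~ writes_iheap c aPrev, ~~ writes_iheap c aNode,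
      ~~ writes_rheap c aWgt & ~~ writes_rheap c aVal] ->
  ~~ writes_ireg c vC -> full_hist a b m -> full_hist a b m'.
Proof.
move=> fr cs cC [s [h pm cb]]; exists s; rewrite (frame_ireg fr) //; split=> //.
exact: phist_frame fr cs h.
Qed.

Lemma clear_spec a m : sane m -> (0 < a)%N ->
  runs clear_histogram m 20 (full_hist a a).
Proof.
move=> sm a0; apply: runs_wp => //=; rewrite !(sane_isize sm); do 3!split=> //.
exists [::]; split=> //; apply: hist_nil.
  by rewrite /chain /= nth_set_nth.
by rewrite /chain /= nth_set_nth.
Qed.

Lemma median_cursor_min a b m : sane m -> (0 < a)%N -> (b <= N.+1)%N ->
  median_cursor a b m ->
  exists y : R, [/\ (ireg m vM <= N)%N, nth 0%E (rheap m aVal) (ireg m vM) =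
    y%:E &
     forall z, dev F W a b y <= dev F W a b z].
Proof.
move=> sm a0 bN [s1 [x [s2 [[h -> _ _] le1 le2]]]].
have xs : x \in s1 ++ x :: s2 by rewrite mem_cat mem_head orbT.
have [i ib [ix vx]] := hist_fin h xs; have /andP[x0 xN] := hist_mem_range h.
exists (F i); split=> // z; exact: (median_min sm a0 bN h).
Qed.

(** Round r only consults earlier values of [p], so the table may be extended at r. *)
Lemma best_before_ext p p' r l (q : R) j :
  (l <= r.+1)%N -> (forall i, (i < r)%N -> p i = p' i) ->
  best_before p r l q j -> best_before p' r l q j.
Proof.
move=> lr e [b1 b2 [y b3]]; split=> //; last by exists y; rewrite -e.
move=> l' z /andP[l0 l'l]; rewrite -e; first by apply: b1; rewrite l0.
by rewrite prednK // -ltnS (leq_trans l'l).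
Qed.

Lemma dynamic_program_spec wmin (K : nat) m : sane m -> (0 < N)%N ->
  0 < wmin -> (forall i, (0 < i <= N)%N -> wmin <= W i <= K%:R * wmin) ->
  runs dynamic_program m ((200 * K + 800) * N * N + 1000 * N + 100) (fun m' =>
    exists p, p 0%N = - gamma /\ forall r, (0 < r <= N)%N ->
      best_before p r r.+1 (p r) (nth 0%N (iheap m' aZ) r)).
Proof.
move=> sm N0 w0 wK.
apply: runs_seq (clear_spec sm (ltn0Sn 0)) _ (_ : 20 + ((200 * K + 800) * N * N
  + 1000 * N + 80) <= _)%N;
  last by lia.
move=> m1 fr1 h1; have sm1 := sane_frame fr1 isT sm.
apply: runs_assoc.
apply: (@runs_seq _ _ _ _ 20 ((200 * K + 800) * N * N + 1000 * N + 60) _ (fun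
  m' =>
  nth 0%E (rheap m' aP) 0 = (- gamma)%:E /\ ireg m' vR = 1%N)); last by lia.
  apply: runs_wp => //=; rewrite (sane_rsize sm1) (sane_gamma sm1); split=> //.
  by split=> //; split=> //; rewrite nth_set_nth /= -EFinB sub0r.
move=> m2 fr2 [P0 R2]; have sm2 := sane_frame fr2 isT sm1.
have h2 : full_hist 1 1 m2 by apply: full_hist_frame fr2 isT isT h1.
(* The existential [p] is the table of real values in P found so far; the constant [- gamma] starts
   it, as only its value at 0 is read. *)
apply: (runs_while (k := N) (B := ((200 * K + 800) * N + 900)%N) (I := fun k m'
  =>
  exists r, [/\ k = (N.+1 - r)%N, (0 < r <= N.+1)%N, ireg m' vR = r,
    full_hist 1 r m' & exists p, [/\ p 0%N = - gamma,
      forall j, (j < r)%N -> nth 0%E (rheap m' aP) j = (p j)%:E &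
      forall j, (0 < j < r)%N ->
        best_before p j j.+1 (p j) (nth 0%N (iheap m' aZ) j)]])).
- exists 1%N; split=> //; first by rewrite subn1.
  exists (fun=> - gamma); split=> //; first by case.
  by case=> [|[]].
- move=> k m3 fr3 [r [ks /andP[r0 rN1] R3 h3 [p [p0 P3 Z3]]]].
  have sm3 := sane_frame fr3 isT sm2.
  rewrite /= R3 (sane_N sm3); split=> //; case: leqP => [rN|Nr]; last first.
    by exists p; split=> // j /andP[j0 jN]; apply: Z3;
      rewrite j0 (leq_ltn_trans jN).
  have rr : (0 < r <= N)%N by rewrite r0.
  apply: (@runs_seq _ _ _ _ 20 ((200 * K + 800) * N + 880) _ (fun m' =>
    nth 0%E (rheap m' aP) r = +oo%E /\
    forall j, (j < r)%N -> nth 0%E (rheap m' aP) j = (p j)%:E)); last by lia.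
    apply: runs_wp => //=; rewrite R3 (sane_rsize sm3) ltnS rN; split=> //.
    split; first by rewrite nth_set_nth /= eqxx.
    by move=> j jr; rewrite nth_set_nth /= ltn_eqF // P3.
  move=> m4 fr4 [Pr4 P4]; have sm4 := sane_frame fr4 isT sm3.
  have h4 : full_hist 1 r m4 by apply: full_hist_frame fr4 isT isT h3.
  have R4 : ireg m4 vR = r by rewrite (frame_ireg fr4).
  apply: runs_seq (insert_spec sm4 _ _ R4 _ rN h4) _
    (_ : (30 * N + 100) + ((200 * K + 760) * N + 780) <= _)%N => //;
      last by lia.
  move=> m5 fr5 h5; have sm5 := sane_frame fr5 isT sm4.
  have [s [ph5 _ _]] := h5.
  apply: runs_seq (reset_spec sm5 ph5) _
    (_ : (40 * N + 100) + ((200 * K + 720) * N + 680) <= _)%N; last by lia.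
  move=> m6 fr6 th6; have sm6 := sane_frame fr6 isT sm5.
  have h6 : full_hist 1 r.+1 m6 by apply: full_hist_frame fr6 isT isT h5.
  have r1 : (0 < 1 < r.+1)%N by rewrite ltnS.
  have rN1' : (r.+1 <= N.+1)%N by [].
  apply: runs_seq (find_median_spec sm6 r1 rN1' th6) _
    (_ : (60 * N + 100) + ((200 * K + 660) * N + 580) <= _)%N; last by lia.
  move=> m7 fr7 med7; have sm7 := sane_frame fr7 isT sm6.
  have h7 : full_hist 1 r.+1 m7 by apply: full_hist_frame fr7 isT isT h6.
  have [y [M7 V7 min7]] := median_cursor_min sm7 (ltn0Sn 0) rN1' med7.
  have [s1 [x [s2 [[th7 M7x L7 R7] le1 le2]]]] := med7.
  apply: runs_seq (sum_deviations_spec sm7 M7 V7 th7) _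
    (_ : (60 * N + 100) + ((200 * K + 600) * N + 480) <= _)%N; last by lia.
  move=> m8 fr8 D8; have sm8 := sane_frame fr8 isT sm7.
  have h8 : full_hist 1 r.+1 m8 by apply: full_hist_frame fr8 isT isT h7.
  have th8 := thist_frame fr8 isT th7.
  have c8 : cut 1 r.+1 s1 true x s2 y m8.
    apply: (cut_linked sm8 _ _ th8) => //.
    - by rewrite (frame_ireg fr8).
    - by rewrite (frame_rheap fr8) // -M7x.
    - by rewrite (frame_rreg fr8) // L7 (mass_frame _ _ _ fr8).
    - by rewrite (frame_rreg fr8) // R7 (mass_frame _ _ _ fr8).
  apply: (@runs_seq _ _ _ _ 10 ((200 * K + 600) * N + 470) _ (fun m' => ireg m'
    vL = 1%N));
    last by lia.
    by apply: runs_wp.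
  move=> m9 fr9 L9; have sm9 := sane_frame fr9 isT sm8.
  have h9 : full_hist 1 r.+1 m9 by apply: full_hist_frame fr9 isT isT h8.
  have bal9 : balanced 1 r.+1 0 0 m9.
    exists s1, x, s2, y; rewrite !addr0 !(mass_frame _ _ _ fr9) // !(mass_frame
      _ _ _ fr8) //.
    by split=> //; apply: cut_frame fr9 isT isT c8.
  have P9 : rheap m9 aP = rheap m4 aP.
    by rewrite (frame_rheap fr9) // (frame_rheap fr8) // (frame_rheap fr7) //
      (frame_rheap fr6) // (frame_rheap fr5).
  have Z9 : iheap m9 aZ = iheap m3 aZ.
    by rewrite (frame_iheap fr9) // (frame_iheap fr8) // (frame_iheap fr7) //
      (frame_iheap fr6) // (frame_iheap fr5) // (frame_iheap fr4).
  have R9 : ireg m9 vR = r.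
    by rewrite (frame_ireg fr9) // (frame_ireg fr8) // (frame_ireg fr7) //
      (frame_ireg fr6) // (frame_ireg fr5).
  apply: (runs_seq (T1 := ((200 * K + 500) * N + 20)%N) (T2 := 30));
    last by lia.
    by apply: (scan_loop_spec (p := p) sm9 rr w0 wK R9 L9 bal9); rewrite P9.
  move=> m10 fr10 [P10 Z10 sc10].
  have r1E : (r.+1 == 1%N) = false by case: (r) r0.
  have [q [Pq bq]] : exists q, nth 0%E (rheap m10 aP) r = q%:E /\
       best_before p r r.+1 q (nth 0%N (iheap m10 aZ) r).
    by move: sc10; rewrite /scanned r1E.
  apply: runs_wp => //=; rewrite (frame_ireg fr10) // R9; split=> //.
  exists (N.+1 - r.+1)%N; first by rewrite ks; lia.
  exists r.+1; split=> //=; first by rewrite addn1.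
    have [s' [ph pm cb]] := h9; exists s'.
    by rewrite /= (frame_ireg fr10) //; split=> //;
      apply: phist_frame fr10 isT ph.
  pose p' j := if j == r then q else p j.
  have pp' i : (i < r)%N -> p i = p' i by rewrite /p' => ir; rewrite ltn_eqF.
  exists p'; split.
  + by rewrite -pp'.
  + move=> j; rewrite ltnS leq_eqVlt /p'; case: eqP => [->//|/eqP jr /= jr'].
    by rewrite P10 // P9 P4.
  + move=> j /andP[j0]; rewrite ltnS leq_eqVlt => /orP[/eqP->|jr].
      rewrite {2}/p' eqxx; exact: best_before_ext bq.
    rewrite -pp' // Z10 ?Z9 ?(ltn_eqF jr) //.
    apply: (@best_before_ext p) => //; last by apply: Z3; rewrite j0.
    by move=> i ij; apply: pp'; apply: ltn_trans jr.
- rewrite /=; lia.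
Qed.

(** * Reconstruction of the minimizer *)

Lemma fill_spec a b m : sane m -> (a < b <= N)%N ->
  ireg m vB = b -> ireg m vI = a.+1 -> full_hist a.+1 a.+1 m ->
  runs (While (BIle vI vB) (Seq (insert vI) (SetI vI (vI + 1%N)%iexp))) m
    ((b - a) * (30 * N + 120) + 10) (full_hist a.+1 b.+1).
Proof.
move=> sm /andP[ab bN] mB mI h.
apply: (runs_while (k := (b - a)%N) (B := (30 * N + 110)%N) (I := fun k m' =>
  exists i,
  [/\ k = (b.+1 - i)%N, (a < i <= b.+1)%N, ireg m' vI = i & full_hist a.+1 i
    m'])).
- by exists a.+1; rewrite subSS; split=> //; rewrite leqnn ltnS ltnW.
- move=> k m1 fr1 [i [ks /andP[ai ib1] I1 h1]];
  have sm1 := sane_frame fr1 isT sm.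
  have B1 : ireg m1 vB = b by rewrite (frame_ireg fr1).
  rewrite /= I1 B1; split=> //; case: leqP => [ib|bi]; last first.
    by have <- : i = b.+1 by apply/eqP; rewrite eqn_leq ib1.
  apply: runs_seq (insert_spec sm1 _ _ I1 _ (leq_trans ib bN) h1) _
    (_ : (30 * N + 100) + 10 <= _)%N => //; last by lia.
  move=> m2 fr2 h2; apply: runs_wp => //=; rewrite (frame_ireg fr2) // I1;
    split=> //.
  exists (b.+1 - i.+1)%N; first by rewrite ks; lia.
  exists i.+1; split=> //=; first by rewrite ltnS (ltnW ai) ltnS.
    by rewrite addn1.
- rewrite /=; apply: (@leq_trans ((b - a) * (30 * N + 120) + 3))%N; last by lia.
  by rewrite leq_add2r leq_mul //; lia.
Qed.

Lemma write_spec a b (y : R) m : sane m -> (a < b <= N)%N ->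
  ireg m vB = b -> ireg m vI = a.+1 -> (ireg m vM <= N)%N ->
  nth 0%E (rheap m aVal) (ireg m vM) = y%:E ->
  runs (While (BIle vI vB) (Seq (PutR aU vI aVal.[vM]) (SetI vI (vI +
    1%N)%iexp))) m
    ((b - a) * 20 + 10) (fun m' => forall i, nth 0%E (rheap m' aU) i =
      if (a < i <= b)%N then y%:E else nth 0%E (rheap m aU) i).
Proof.
move=> sm /andP[ab bN] mB mI MN Vy.
apply: (runs_while (k := (b - a)%N) (B := 15) (I := fun k m' => exists i,
  [/\ k = (b.+1 - i)%N, (a < i <= b.+1)%N, ireg m' vI = i &
    forall j, nth 0%E (rheap m' aU) j =
      if (a < j < i)%N then y%:E else nth 0%E (rheap m aU) j])).
- exists a.+1; rewrite subSS; split=> //; first by rewrite leqnn ltnS ltnW.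
  by move=> j; rewrite ltnS ltnNge andNb.
- move=> k m1 fr1 [i [ks /andP[ai ib1] I1 U1]];
  have sm1 := sane_frame fr1 isT sm.
  have B1 : ireg m1 vB = b by rewrite (frame_ireg fr1).
  have M1 : ireg m1 vM = ireg m vM by rewrite (frame_ireg fr1).
  have V1 : rheap m1 aVal = rheap m aVal by rewrite (frame_rheap fr1).
  rewrite /= I1 B1; split=> //; case: leqP => [ib|bi]; last first.
    have ie : i = b.+1 by apply/eqP; rewrite eqn_leq ib1.
    by move=> j; rewrite U1 ie ltnS.
  apply: runs_wp => //=; rewrite I1 M1 V1 Vy (sane_rsize sm) (sane_rsize sm1)
    !ltnS MN (leq_trans ib bN).
  split=> //; split=> //; exists (b.+1 - i.+1)%N; first by rewrite ks; lia.
  exists i.+1; split=> //=; first by rewrite ltnS (ltnW ai) ltnS.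
    by rewrite addn1.
  move=> j; rewrite nth_set_nth /= U1 [(j < i.+1)%N]ltnS [(j <= i)%N]leq_eqVlt.
  by case: eqP => [->|_] //=; rewrite ai.
- by rewrite /=; lia.
Qed.

(** Invariant at a block boundary b: [p b], one jump if anything follows, and the cost of what is
    already written after b stay below [p N]. With b = 0 this bounds the cost of the whole
    output. *)
Lemma reconstruct_spec p m : sane m -> 0 <= gamma ->
  (forall r, (0 < r <= N)%N -> best_before p r r.+1 (p r) (nth 0%N (iheap m aZ)
    r)) ->
  nth 0%E (rheap m aU) 0 = 0%E ->
  runs reconstruct m ((130 * N + 460) * N + 20) (fun m' =>
    nth 0%E (rheap m' aU) 0 = 0%E /\ exists u : nat -> R,
      (forall i, (0 < i <= N)%N -> nth 0%E (rheap m' aU) i = (u i)%:E) /\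
      p 0%N + gamma * (0 < N)%:R + (misfit F W 1 N.+1 u + penalty gamma 1 N u)
        <= p N).
Proof.
move=> sm g0 bZ U0.
apply: (@runs_seq _ _ _ _ 5 ((130 * N + 460) * N + 10) _ (fun m' => ireg m' vB
  = N));
  last by lia.
  by apply: runs_wp => //=; rewrite (sane_N sm).
move=> m1 fr1 B1; have sm1 := sane_frame fr1 isT sm.
(* The boundary b itself is the potential: a block of length b - a costs O((b - a) N), and the
   lengths add up to [N]. *)
apply: (runs_while_amortized (k := N) (B := (130 * N + 455)%N) (I := fun b m' =>
  [/\ (b <= N)%N, ireg m' vB = b, nth 0%E (rheap m' aU) 0 = 0%E & exists u :
    nat -> R,
      (forall i, (b < i <= N)%N -> nth 0%E (rheap m' aU) i = (u i)%:E) /\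
      p b + gamma * (b < N)%:R + (misfit F W b.+1 N.+1 u + penalty gamma b.+1 N
        u) <= p N])).
- split=> //; first by rewrite (frame_rheap fr1).
  exists (fun=> 0); split; first by move=> i /andP[/leq_trans h /h];
    rewrite ltnn.
  by rewrite ltnn mulr0 addr0 /misfit /penalty !big_geq // mulr0 !addr0.
- move=> b m2 fr2 [bN B2 U2 [u [Uu le]]]; have sm2 := sane_frame fr2 isT sm1.
  rewrite /= B2; split=> //; case: ifPn => [|/negPn/eqP b0]; last first.
    by split=> //; exists u; rewrite b0 in Uu le *.
  rewrite -lt0n => b0.
  have Z2 : iheap m2 aZ = iheap m aZ by rewrite (frame_iheap fr2) //
    (frame_iheap fr1).
  have [|_ ab [y0 py0]] := bZ b; first by rewrite b0.
  set a := nth _ _ _ in ab py0.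
  have abN : (a < b <= N)%N by rewrite ab.
  exists ((b - a) * (30 * N + 150) + 100 * N + 280)%N.
  apply: (@runs_seq _ _ _ _ 5 ((b - a) * (30 * N + 150) + 100 * N + 275) _ (fun
    m' => ireg m' vA = a));
    last by lia.
    by apply: runs_wp => //=; rewrite B2 (sane_isize sm2) Z2 ltnS.
  move=> m3 fr3 A3; have sm3 := sane_frame fr3 isT sm2.
  apply: runs_seq (clear_spec sm3 (ltn0Sn a)) _
    (_ : 20 + ((b - a) * (30 * N + 150) + 100 * N + 255) <= _)%N; last by lia.
  move=> m4 fr4 h4; have sm4 := sane_frame fr4 isT sm3.
  apply: (@runs_seq _ _ _ _ 10 ((b - a) * (30 * N + 150) + 100 * N + 245) _
    (fun m' => ireg m' vI = a.+1)); last by lia.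
    by apply: runs_wp => //=; rewrite (frame_ireg fr4) // A3 addn1.
  move=> m5 fr5 I5; have sm5 := sane_frame fr5 isT sm4.
  have h5 : full_hist a.+1 a.+1 m5 by apply: full_hist_frame fr5 isT isT h4.
  have B5 : ireg m5 vB = b by rewrite (frame_ireg fr5) // (frame_ireg fr4) //
    (frame_ireg fr3).
  apply: runs_seq (fill_spec sm5 abN B5 I5 h5) _
    (_ : ((b - a) * (30 * N + 120) + 10) + ((b - a) * 30 + 100 * N + 235) <=
      _)%N; last by lia.
  move=> m6 fr6 [s [h6 _ _]]; have sm6 := sane_frame fr6 isT sm5.
  apply: runs_seq (reset_spec sm6 h6) _
    (_ : (40 * N + 100) + ((b - a) * 30 + 60 * N + 135) <= _)%N; last by lia.
  move=> m7 fr7 th7; have sm7 := sane_frame fr7 isT sm6.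
  have ab1 : (0 < a.+1 < b.+1)%N by [].
  apply: runs_seq (find_median_spec sm7 ab1 bN th7) _
    (_ : (60 * N + 100) + ((b - a) * 30 + 35) <= _)%N; last by lia.
  move=> m8 fr8 med; have sm8 := sane_frame fr8 isT sm7.
  have [y [M8 V8 min8]] := median_cursor_min sm8 (ltn0Sn a) (bN : (b.+1 <=
    N.+1)%N) med.
  have A8 : ireg m8 vA = a.
    by rewrite (frame_ireg fr8) // (frame_ireg fr7) // (frame_ireg fr6) //
      (frame_ireg fr5) // (frame_ireg fr4).
  have B8 : ireg m8 vB = b.
    by rewrite (frame_ireg fr8) // (frame_ireg fr7) // (frame_ireg fr6).
  have U8 : rheap m8 aU = rheap m2 aU.
    by rewrite (frame_rheap fr8) // (frame_rheap fr7) // (frame_rheap fr6) //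
     (frame_rheap fr5) // (frame_rheap fr4) // (frame_rheap fr3).
  apply: (@runs_seq _ _ _ _ 10 ((b - a) * 30 + 25) _ (fun m' => ireg m' vI =
    a.+1)); last by lia.
    by apply: runs_wp => //=; rewrite A8 addn1.
  move=> m9 fr9 I9; have sm9 := sane_frame fr9 isT sm8.
  apply: (runs_seq (T2 := 10) (write_spec (y := y) sm9 abN _ I9 _ _));
    last by lia.
  + by rewrite (frame_ireg fr9).
  + by rewrite (frame_ireg fr9).
  + by rewrite (frame_rheap fr9) // (frame_ireg fr9).
  move=> m10 fr10 U10; apply: runs_wp => //=.
  rewrite (frame_ireg fr10) // (frame_ireg fr9) // A8; split=> //.
  have U9 : rheap m9 aU = rheap m2 aU by rewrite (frame_rheap fr9).
  rewrite U9 in U10.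
  exists a; split=> //.
    (* Blocks are nonempty, so the cost that is independent of the length is absorbed as well. *)
    have [L Lab] : exists L, (b - a = L.+1)%N by exists (b - a).-1;
      rewrite prednK // subn_gt0.
    by rewrite Lab; nia.
  split=> //=; first by rewrite ltnW // (leq_trans ab).
    by rewrite U10 ltn0.
  pose u' i := if (a < i <= b)%N then y else u i.
  exists u'; split.
    move=> i /andP[ai iN]; rewrite U10 /u' ai /=; case: leqP => // bi.
    by apply: Uu; rewrite bi.
  have := @segmentation_step _ F W gamma a b N u u' y g0 abN.
  have -> : (a < N)%N by apply: leq_trans bN.
  rewrite mulr1 => step; have {}step := step _ _.
  have s1 : misfit F W a.+1 N.+1 u' + penalty gamma a.+1 N u' <=
     dev F W a.+1 b.+1 y + gamma * (b < N)%:R + (misfit F W b.+1 N.+1 u +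
       penalty gamma b.+1 N u).
    apply: step => i; rewrite /u' ; first by move->.
    by case/andP=> bi _; rewrite [(i <= b)%N]leqNgt bi andbF.
  (* [best_before] only provides some constant [y0] for the block; the median [y] written by the
     program is at least as good. *)
  have := min8 y0; move: s1 py0 le; lra.
- by rewrite /=; lia.
Qed.

End Specs.

(** * The main theorem *)

Section Coordinates.
Variables (R : realDomainType) (n : nat).
Implicit Types (u v f w : 'rV[R]_n).

(* Coordinates are counted from 1, as in the cells of vec_array. *)
Definition coord v (i : nat) : R := if insub i.-1 is Some j then v 0 j else 0.

Lemma coordS v (i : 'I_n) : coord v i.+1 = v 0 i.
Proof. by rewrite /coord /= valK. Qed.

Lemma size_vec_array v : size (vec_array v) = n.+1.
Proof. by rewrite /= size_map size_enum_ord. Qed.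

Lemma nth_vec_array v i : (0 < i <= n)%N ->
  nth 0%E (vec_array v) i = (coord v i)%:E.
Proof.
case: i => // i /= i_n; rewrite (nth_map (Ordinal i_n)) ?size_enum_ord //.
by rewrite -(coordS v) nth_enum_ord.
Qed.

Lemma jumps_coord v : jumps v = (\sum_(1 <= i < n) (coord v i != coord v
  i.+1))%N.
Proof.
rewrite /jumps -sum1_card big_add1 big_mkord.
rewrite (eq_bigl (fun ij : 'I_n * 'I_n => (ij.2 == ij.1.+1 :> nat) && (v 0 ij.1
  != v 0 ij.2)));
  last by move=> ij; rewrite inE.
rewrite -(pair_big_dep xpredT (fun i j : 'I_n => (j == i.+1 :> nat) && (v 0 i
  != v 0 j)) (fun _ _ => 1%N)) /=.
(* The inner sum over j has at most the term j = i + 1, which is missing for the last i. *)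
transitivity (\sum_(i < n) (if (i.+1 < n)%N then (coord v i.+1 != coord v i.+2
  : nat) else 0))%N.
  apply: eq_bigr => i _; case: ifPn => [i_n|]; last first.
    rewrite -leqNgt => ni; rewrite big_pred0 // => j;
      apply/andP => -[/eqP ji _].
    by move: (ltn_ord j); rewrite ji ltnNge ni.
  rewrite big_mkcondr /= (big_pred1 (Ordinal i_n)) /=; last first.
    by move=> j; rewrite /= -val_eqE.
  by rewrite -!coordS /=; case: (_ != _).
case: (n) => [|k]; first by rewrite !big_ord0.
rewrite big_ord_recr /= ltnn addn0; apply: eq_bigr => i _.
by rewrite ltnS ltn_ord.
Qed.

Lemma potts_coord gamma w f v :
  potts gamma w f v = misfit (coord f) (coord w) 1 n.+1 (coord v) + penalty
    gamma 1 n (coord v).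
Proof.
rewrite /potts addrC jumps_coord; congr (_ + _).
rewrite /misfit big_add1 big_mkord; apply: eq_bigr => i _.
by rewrite !coordS distrC.
Qed.

End Coordinates.

(** * Allocation, space, and assembly of the three phases *)

Lemma allocate_spec (R : realDomainType) n (gamma : R) (w f : 'rV[R]_n) :
  (forall i, 0 < w 0 i) ->
  runs allocate (input gamma w f) (11 * (n + 10)) (fun m' =>
    sane (coord f) (coord w) gamma n m' /\ nth 0%E (rheap m' aU) 0 = 0%E).
Proof.
move=> w0; rewrite /allocate mulSn.
do 6![apply: (@runs_allocI_seq _ _ _ _ _ (n + 10));
  rewrite //= ?mulSn ?muln0 ?addn0 //; first by lia].
do 4![apply: (@runs_allocR_seq _ _ _ _ _ (n + 10));
  rewrite //= ?mulSn ?muln0 ?addn0 //; first by lia].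
apply: runs_allocR => //=; last by lia.
rewrite addn1; split=> //; split=> //=.
- by case=> /=; rewrite size_nseq.
- by case=> /=; rewrite ?size_nseq // size_map size_enum_ord.
- move=> [//|i] /= i_n; have /= := w0 (Ordinal i_n); by rewrite -coordS.
- by move=> i i_n; rewrite -nth_vec_array.
- by move=> i i_n; rewrite -nth_vec_array.
Qed.

Lemma space_le (R : realDomainType) N (m : memory R) :
  (forall q, size (iheap m q) = N.+1) -> (forall q, size (rheap m q) = N.+1) ->
  (Defs.space m <= 13 * N + 27)%N.
Proof.
move=> si sr; rewrite /Defs.space.
have ci : (#|{: ivar}| <= 9)%N.
  by rewrite -[leqRHS]card_ord; apply: leq_card (pcan_inj ivar_codeK).
have cr : (#|{: rvar}| <= 5)%N.
  by rewrite -[leqRHS]card_ord; apply: leq_card (pcan_inj rvar_codeK).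
have ca : (#|{: iarr}| <= 6)%N.
  by rewrite -[leqRHS]card_ord; apply: leq_card (pcan_inj iarr_codeK).
have cb : (#|{: rarr}| <= 7)%N.
  by rewrite -[leqRHS]card_ord; apply: leq_card (pcan_inj rarr_codeK).
rewrite (eq_bigr _ (fun q _ => si q)) (eq_bigr _ (fun q _ => sr q))
  !sum_nat_const.
(* Nine index registers, five real registers, six index arrays and seven real arrays. *)
apply: (@leq_trans (9 + 5 + 6 * N.+1 + 7 * N.+1)%N); last by lia.
by rewrite !leq_add ?leq_mul.
Qed.

Theorem theorem3p3 (R : realType) (gamma : R) (n : nat -> nat)
    (w : forall k : nat, 'rV[R]_(n k)) (C : R)
    (gamma_gt0 : 0 < gamma)
    (n_gt0 : forall k : nat, (0 < n k)%N)
    (n_incr : forall j k : nat, (j <= k)%N -> (n j <= n k)%N)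
    (w_gt0 : forall (k : nat) (i : 'I_(n k)), 0 < w k 0 i)
    (w_ratio : forall k : nat, max_entry (w k) / min_entry (w k) <= C) :
  exists K : nat, forall (k : nat) (f : 'rV[R]_(n k)),
    exists (t s : nat) (m : memory R) (u : 'rV[R]_(n k)),
      [/\ exec l1_potts (input gamma (w k) f) t s m,
          rheap m aU = vec_array u,
          potts_minimizer gamma (w k) f u,
          (t <= K * n k ^ 2)%N
        & (s <= K * n k)%N].
Proof.
have max_gt0 k : 0 < max_entry (w k).
  exact: lt_le_trans (w_gt0 k (Ordinal (n_gt0 k))) (le_bigmax _ _ _).
(* The default of the iterated minimum is the maximum, already known to be positive. *)
have min_gt0 k : 0 < min_entry (w k) by apply: lt_bigmin.
have C_ge0 : 0 <= C.
  by apply: le_trans (w_ratio 0%N); rewrite divr_ge0 // ltW.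
pose K0 := Num.Def.archi_bound C.
have CK : C <= K0%:R by apply: ltW; apply: archi_boundP.
(* [K0] is an integer bound for the weight ratio, hence for the number of shifts in a loop. The
   summand 3000 absorbs the lower order terms of all three phases, since [n k] is at least 1. *)
exists (200 * K0 + 3000)%N => k f.
set N := n k; have N0 : (0 < N)%N := n_gt0 k.
pose wmin := min_entry (w k).
have wK i : (0 < i <= N)%N -> wmin <= coord (w k) i <= K0%:R * wmin.
  case: i => // i /= i_n; rewrite -[i]/(val (Ordinal i_n)) coordS bigmin_le /=.
  apply: le_trans (le_bigmax 0 _ _) _; apply: le_trans (_ : C * wmin <= _).
    by rewrite -ler_pdivrMr ?min_gt0 //; apply: w_ratio.
  by rewrite ler_pM2r; [exact: CK | exact: min_gt0].
suff [t [s [m [E tT ss _ [sm [u [U0 Uu mu]]]]]]] :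
    runs l1_potts (input gamma (w k) f)
      (11 * (N + 10) + (((200 * K0 + 800) * N * N + 1000 * N + 100) +
       ((130 * N + 460) * N + 20)))
      (fun m => sane (coord f) (coord (w k)) gamma N m /\ exists u : nat -> R,
        [/\ nth 0%E (rheap m aU) 0 = 0%E,
            forall i, (0 < i <= N)%N -> nth 0%E (rheap m aU) i = (u i)%:E &
            forall v, misfit (coord f) (coord (w k)) 1 N.+1 u + penalty gamma 1
              N u <=
              potts gamma (w k) f v]).
  have cu i : (0 < i <= N)%N -> coord (\row_(j < n k) u j.+1) i = u i.
    by case: i => // i /= i_n; rewrite -[i]/(val (Ordinal i_n)) coordS mxE.
  exists t, s, m, (\row_j u j.+1); split=> //.
  - apply: (@eq_from_nth _ 0%E); rewrite (sane_rsize sm) ?size_vec_array // =>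
    i.
    case: i => [|i] iN; first by rewrite U0.
    by rewrite Uu // nth_vec_array ?cu.
  - move=> v; apply: le_trans (mu v); rewrite potts_coord.
    rewrite (eq_misfit _ _ (v' := u)); last by move=> i iN; rewrite cu.
    rewrite lerD2l /penalty ler_wpM2l ?(ltW gamma_gt0) // ler_nat;
      apply: eq_leq.
    by apply: eq_big_nat => i /andP[i0 iN]; rewrite !cu // ?i0 ?(ltnW iN).
  - by apply: leq_trans tT _; rewrite -/N expnS expn1; nia.
  - apply: leq_trans ss _; apply: leq_trans (space_le (sane_isize sm)
    (sane_rsize sm)) _.
    by rewrite -/N; nia.
apply: runs_seq (allocate_spec gamma f (w_gt0 k)) _ (leqnn _) => m1 fr1 [sm1
  U1].
apply: runs_seq (dynamic_program_spec sm1 N0 (min_gt0 k) wK) _ (leqnn _).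
move=> m2 fr2 [p [p0 bp]]; have sm2 := sane_frame fr2 isT sm1.
apply: runs_weaken (reconstruct_spec sm2 (ltW gamma_gt0) bp _) _ (leqnn _).
  by rewrite (frame_rheap fr2).
move=> m3 fr3 [U3 [u [Uu le]]]; split; first exact: sane_frame fr3 isT sm2.
exists u; split=> // v; rewrite potts_coord.
(* The start value [- gamma] cancels the jump that the invariant charges before the first block. *)
move: le; rewrite p0 N0 mulr1 addNr add0r => /le_trans; apply.
rewrite addrC; apply: (segmentation_lower _ p0) => // r l y /andP[l0 lr] rN.
have [|b _ _] := bp r; first by rewrite (leq_trans l0).
by apply: b; rewrite l0.
Qed.
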